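(* Let $g(z)$ and $h(z)$ be two entire functions, each of order lying in $(0,1)$, such that $g(0)=h(0)=1$. Suppose that the zeros of $g$ are all simple and positive and are given by a strictly increasing sequence of positive numbers $\{a_n,\ n\ge 1\}$, and that the zeros of $h$ are all simple and positive and are given by a strictly increasing sequence of positive numbers $\{b_n,\ n\ge 1\}$. Assume that $a_n<b_n$ for all $n$. Then $\varphi(t)=h(it)/g(it)$, $t\in\mathbb{R}$, is the characteristic function of a probability measure on $[0,\infty)$.
   Context: A ''strictly increasing sequence of positive numbers'' $\{a_n,\ n\ge1\}$ means $0<a_1<a_2<\cdots$ with $\lim_{n\to\infty}a_n=\infty$. The order of an entire function is its usual order of growth. The characteristic function of a probability measure $P$ on $\mathbb{R}$ is $t\mapsto\int e^{itx}\,P(dx)$. *)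

(* Defs.v *)
From HB Require Import structures.
From mathcomp Require Import all_boot all_order all_algebra.
From mathcomp Require Import all_classical all_reals all_analysis.
From mathcomp Require Import complex.

Set Implicit Arguments.
Unset Strict Implicit.
Unset Printing Implicit Defensive.

Import Order.TTheory GRing.Theory Num.Theory.
Import numFieldNormedType.Exports.

Local Open Scope classical_set_scope.
Local Open Scope ring_scope.
Local Open Scope complex_scope.

Section ComplexFunctions.
Context {R : realType}.

(* As [R[i]] is a normed module over itself, differentiability in the direction
   [1] is the existence of the limit of (f (z + w) - f z) / w as the complex
   number w tends to 0. *)
Definition entire (f : R[i] -> R[i]) : Prop :=
  forall z : R[i], derivable (f : R[i]^o -> R[i]^o) z 1.

(* M(r) = max_(|z| = r) |f z|, with [normc] the modulus as an element of [R]. *)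
Definition max_modulus (f : R[i] -> R[i]) (r : R) : R :=
  sup [set Normc.normc (f z) | z in [set z : R[i] | Normc.normc z = r]].

(* limsup_(r -> +oo) log log M(r) / log r. *)
Definition growth_order (f : R[i] -> R[i]) : \bar R :=
  limf_esup (fun r : R => (ln (ln (max_modulus f r)) / ln r)%:E) +oo%R.

Definition simple_zero (f : R[i] -> R[i]) (z : R[i]) : Prop :=
  f z = 0 /\ derive1 (f : R[i]^o -> R[i]^o) z != 0.

End ComplexFunctions.

(* The term [a n] is the (n+1)-st term of a sequence indexed from 1. *)
Definition increasing_positive_seq {R : realType} (a : nat -> R) : Prop :=
  [/\ forall n, 0 < a n, forall n, a n < a n.+1 & a n @[n --> \oo] --> +oo].

Definition simple_zeros_given_by {R : realType}
    (f : R[i] -> R[i]) (a : nat -> R) : Prop :=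
  [set z | f z = 0] = range (fun n => (a n)%:C) /\
  (forall z, f z = 0 -> simple_zero f z).

(* The integral of exp(itx) = cos(tx) + i sin(tx), taken componentwise. *)
Definition characteristic_function {R : realType}
    (P : probability (measurableTypeR R) R) (t : R) : R[i] :=
  (\int[P]_x cos (t * x))%R +i* (\int[P]_x sin (t * x))%R.

(* Main.v *)
Require Import Defs.
From HB Require Import structures.
From mathcomp Require Import all_boot all_order all_algebra.
From mathcomp Require Import all_classical all_reals all_analysis.
From mathcomp Require Import measurable_realfun complex ring lra.

Set Implicit Arguments.
Unset Strict Implicit.
Unset Printing Implicit Defensive.

Import Order.TTheory GRing.Theory Num.Theory.
Import numFieldNormedType.Exports.

Local Open Scope classical_set_scope.
Local Open Scope ring_scope.
Local Open Scope complex_scope.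

Local Notation Re := complex.Re.
Local Notation Im := complex.Im.

(** An entire function of order less than 1 is determined by its zeros and its
value at 0: [g z] is the product of the [1 - z / a n], and similarly for
[h]. Hence [h (it) / g (it)] is the limit of finite products of the factors
[(1 - it / b n) / (1 - it / a n)]. Since [0 < a n < b n], such a factor is
the characteristic function of a law on the half-line: the mixture that puts
weight [a n / b n] on the point 0 and weight [1 - a n / b n] on the
exponential law of rate [a n] ([exists_factor_law]). A finite product of
factors is the characteristic function of a sum of independent variables
([exists_partial_laws]), and what remains is to justify the two limits.

The factorization ([cvgc_canonical_product]). Write [g = p * G], where [p]
is the product of the first [N] factors and [G] is entire ([divide_zero]).
As the zeros of [g] are simple, [G] has no zero in the disc of radius [a N].
On the circle of radius [2 * a N] every factor of [p] has modulus at least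
1, so there [|G| <= |g|], and [|g|] is at most [expR (d * (2 * a N))] with
[d] as small as desired once [N] is large, because the order is less than 1.
A function without zeros that takes the value 1 at 0 and is bounded by [expR
A] on a disc is close to 1 near the centre when [A] is small with respect to
the radius ([near1_of_bound]); therefore [G] tends to 1 pointwise.

This needs Cauchy's formula. It is derived from Goursat's theorem on
rectangles by means over circles about 0: the mean of [f] over the circle of
radius [s] is, up to a constant, the integral of the function [f] composed
with the exponential over a vertical segment of length [2 * pi], so that it
does not depend on [s] ([mean_annulus], [mean_value]).

The limit of the laws ([limit_law]). The partial laws are those of sums of
independent nonnegative variables, so their distribution functions decrease
with [n] and their quantile functions increase. They are tight, because the
series of the [(a n)^-1] converges, as the convergence of the product at
[-1] shows ([sum_inv_bounded]). Hence the quantile functions, seen as random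
variables on the unit interval, converge pointwise; the law of their limit
is carried by the half-line, and dominated convergence gives the convergence
of the characteristic functions. *)

(** * Modulus and limits of complex numbers *)

Section complex_numbers.
Context {R : realType}.
Implicit Types (z w : R[i]) (x y : R).

Notation nc := (@Normc.normc R).

Lemma nc_ge0 z : 0 <= nc z.
Proof. by case: z => a b; rewrite sqrtr_ge0. Qed.

Lemma sqr_nc z : nc z ^+ 2 = Re z ^+ 2 + Im z ^+ 2.
Proof. by case: z => a b /=; rewrite sqr_sqrtr// addr_ge0 ?sqr_ge0. Qed.

Lemma nc0 : nc 0 = 0. Proof. exact: Normc.normc0. Qed.

Lemma nc1 : nc 1 = 1. Proof. exact: Normc.normc1. Qed.

Lemma nc_eq0 z : (nc z == 0) = (z == 0).
Proof.
by apply/eqP/eqP => [|->]; [exact: Normc.eq0_normc|exact: nc0].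
Qed.

Lemma nc_gt0 z : (0 < nc z) = (z != 0).
Proof. by rewrite lt_neqAle nc_ge0 andbT eq_sym nc_eq0. Qed.

Lemma ncN z : nc (- z) = nc z. Proof. exact: normcN. Qed.

Lemma ncBC z w : nc (z - w) = nc (w - z).
Proof. by rewrite -ncN opprB. Qed.

Lemma ncM z w : nc (z * w) = nc z * nc w. Proof. exact: Normc.normcM. Qed.

Lemma ncV z : nc z^-1 = (nc z)^-1. Proof. exact: Normc.normcV. Qed.

Lemma ncX z n : nc (z ^+ n) = nc z ^+ n.
Proof. by elim: n => [|n ih]; rewrite ?nc1// !exprS ncM ih. Qed.

Lemma le_ncD z w : nc (z + w) <= nc z + nc w. Proof. exact: le_normcD. Qed.

Lemma le_ncB z w : nc (z - w) <= nc z + nc w.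
Proof. by rewrite -(ncN w); exact: le_ncD. Qed.

Lemma nc_triangle u z w : nc (z - w) <= nc (z - u) + nc (u - w).
Proof. by apply: le_trans (le_ncD _ _); rewrite addrA subrK. Qed.

Lemma le_nc_subl z w : nc z - nc w <= nc (z - w).
Proof. by rewrite lerBlDr; apply: le_trans (le_ncD _ _); rewrite subrK. Qed.

Lemma nc_real x : nc x%:C = `|x|.
Proof. by rewrite /= expr0n/= addr0 sqrtr_sqr. Qed.

Lemma nc_conj z : nc (conjc z) = nc z.
Proof. by case: z => a b /=; rewrite sqrrN. Qed.

Lemma norm_Re_le z : `|Re z| <= nc z.
Proof.
rewrite -ler_sqr ?nnegrE ?nc_ge0// sqr_nc real_normK ?num_real//.
by rewrite lerDl sqr_ge0.
Qed.

Lemma norm_Im_le z : `|Im z| <= nc z.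
Proof.
rewrite -ler_sqr ?nnegrE ?nc_ge0// sqr_nc real_normK ?num_real//.
by rewrite lerDr sqr_ge0.
Qed.

Lemma nc_le_ReIm z : nc z <= `|Re z| + `|Im z|.
Proof.
rewrite -ler_sqr ?nnegrE ?nc_ge0 ?addr_ge0// sqr_nc sqrrD.
by rewrite !real_normK ?num_real// addrAC lerDl mulrn_wge0// mulr_ge0.
Qed.

Lemma Re_le_nc z : Re z <= nc z.
Proof. exact: le_trans (ler_norm _) (norm_Re_le z). Qed.

Lemma ReM z w : Re (z * w) = Re z * Re w - Im z * Im w.
Proof. by case: z w => [? ?] [? ?]. Qed.

Lemma ImM z w : Im (z * w) = Re z * Im w + Im z * Re w.
Proof. by case: z w => [? ?] [? ?]. Qed.

Lemma ReD z w : Re (z + w) = Re z + Re w.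
Proof. by case: z w => [? ?] [? ?]. Qed.

Lemma ImD z w : Im (z + w) = Im z + Im w.
Proof. by case: z w => [? ?] [? ?]. Qed.

Lemma ReN z : Re (- z) = - Re z. Proof. by case: z. Qed.

Lemma ImN z : Im (- z) = - Im z. Proof. by case: z. Qed.

Lemma ReB z w : Re (z - w) = Re z - Re w.
Proof. by rewrite ReD ReN. Qed.

Lemma ImB z w : Im (z - w) = Im z - Im w.
Proof. by rewrite ImD ImN. Qed.

Lemma Complex_eq z w : Re z = Re w -> Im z = Im w -> z = w.
Proof. by case: z w => [? ?] [? ?] /= -> ->. Qed.

Lemma conj_mulc z w : conjc (z * w) = conjc z * conjc w.
Proof. by case: z w => [a b] [c d]; apply: Complex_eq => /=; ring. Qed.

Lemma conj_addc z w : conjc (z + w) = conjc z + conjc w.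
Proof. by case: z w => [a b] [c d]; apply: Complex_eq => /=; ring. Qed.

Lemma conj_oppc z : conjc (- z) = - conjc z.
Proof. by case: z. Qed.

Lemma conj_invc z : conjc z^-1 = (conjc z)^-1.
Proof. by case: z => a b; apply: Complex_eq; rewrite /= sqrrN// mulNr. Qed.

Lemma conjc_conjc z : conjc (conjc z) = z.
Proof. by case: z => a b; rewrite /= opprK. Qed.

Lemma mul_conjc z : z * conjc z = (nc z ^+ 2)%:C.
Proof. by rewrite sqr_nc; case: z => a b; apply: Complex_eq => /=; ring. Qed.

Lemma invc_conj z : z^-1 = conjc z * ((nc z ^+ 2)^-1)%:C.
Proof.
have [->|z0] := eqVneq z 0; first by rewrite invr0 nc0 expr0n/= invr0 mulr0.
apply: (mulfI z0); rewrite divff// mulrA.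
by rewrite mul_conjc -rmorphM/= divff// sqrf_eq0 nc_eq0.
Qed.

End complex_numbers.

Local Notation nc := Normc.normc.
#[local] Arguments Normc.normc : simpl never.

Section complex_limits.
Context {R : realType}.

(** Convergence of complex-valued functions by components. The field [R[i]] is
normed over itself, its norm taking values in [R[i]]; working with real
components and with the real-valued modulus lets the theory of real limits
and integrals apply directly. *)
Definition cvgc {T} (F : set_system T) (u : T -> R[i]) (l : R[i]) :=
  Re (u t) @[t --> F] --> Re l /\ Im (u t) @[t --> F] --> Im l.

Section filter.
Context {T : Type} (F : set_system T) {FF : Filter F}.
Implicit Types (u v : T -> R[i]) (k l : R[i]).

Lemma cvgc_nc u l : cvgc F u l <-> nc (u t - l) @[t --> F] --> 0.
Proof.
split=> [[ur ui]|ul].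
  have rl : `|Re (u t) - Re l| @[t --> F] --> 0.
    by rewrite -(normr0 R) -(subrr (Re l)); apply: cvg_norm; apply: cvgB => //; exact: cvg_cst.
  have il : `|Im (u t) - Im l| @[t --> F] --> 0.
    by rewrite -(normr0 R) -(subrr (Im l)); apply: cvg_norm; apply: cvgB => //; exact: cvg_cst.
  apply: (@squeeze_cvgr _ _ _ _ (cst 0) (fun t => `|Re (u t) - Re l| + `|Im (u t) - Im l|)).
  - near=> t; rewrite nc_ge0/=.
    by apply: le_trans (nc_le_ReIm _) _; rewrite ReB ImB.
  - exact: cvg_cst.
  - by rewrite -[0]addr0; exact: cvgD.
split; apply/cvgrPdist_lt => e e0; move/cvgr0Pnorm_lt : ul => /(_ e e0);
  apply: filterS => t; rewrite ger0_norm ?nc_ge0//; apply: le_lt_trans.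
  by rewrite ncBC -ReB; exact: norm_Re_le.
by rewrite ncBC -ImB; exact: norm_Im_le.
Unshelve. all: end_near. Qed.

Lemma cvgc_lt u l : cvgc F u l <->
  forall e : R, 0 < e -> \forall t \near F, nc (u t - l) < e.
Proof.
rewrite cvgc_nc; split=> [/cvgr0Pnorm_lt ul e /ul|ul].
  by apply: filterS => t; rewrite ger0_norm ?nc_ge0.
apply/cvgr0Pnorm_lt => e /ul.
by apply: filterS => t; rewrite ger0_norm ?nc_ge0.
Qed.

Lemma cvgc_squeeze (v : T -> R) u l :
  (\forall t \near F, nc (u t - l) <= v t) -> v t @[t --> F] --> 0 -> cvgc F u l.
Proof.
move=> uv v0; apply/cvgc_nc.
apply: (@squeeze_cvgr _ _ _ _ (cst 0) v) => //; last exact: cvg_cst.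
by apply: filterS uv => t ->; rewrite nc_ge0.
Qed.

Lemma cvgc_cst k : cvgc F (fun=> k) k.
Proof. by split; exact: cvg_cst. Qed.

Lemma cvgcD u v k l : cvgc F u k -> cvgc F v l ->
  cvgc F (fun t => u t + v t) (k + l).
Proof.
move=> [ur ui] [vr vi]; split.
  by under eq_fun do rewrite ReD; rewrite ReD; exact: cvgD.
by under eq_fun do rewrite ImD; rewrite ImD; exact: cvgD.
Qed.

Lemma cvgcN u k : cvgc F u k -> cvgc F (fun t => - u t) (- k).
Proof.
move=> [ur ui]; split.
  by under eq_fun do rewrite ReN; rewrite ReN; exact: cvgN.
by under eq_fun do rewrite ImN; rewrite ImN; exact: cvgN.
Qed.

Lemma cvgcB u v k l : cvgc F u k -> cvgc F v l ->
  cvgc F (fun t => u t - v t) (k - l).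
Proof. by move=> uk vl; apply: cvgcD => //; exact: cvgcN. Qed.

Lemma cvgcM u v k l : cvgc F u k -> cvgc F v l ->
  cvgc F (fun t => u t * v t) (k * l).
Proof.
move=> [ur ui] [vr vi]; split.
  by under eq_fun do rewrite ReM; rewrite ReM; apply: cvgB; exact: cvgM.
by under eq_fun do rewrite ImM; rewrite ImM; apply: cvgD; exact: cvgM.
Qed.

Lemma cvgc_real (u : T -> R) (l : R) :
  u t @[t --> F] --> l -> cvgc F (fun t => (u t)%:C) l%:C.
Proof. by move=> ul; split => //=; exact: cvg_cst. Qed.

Lemma cvgc_conj u k : cvgc F u k -> cvgc F (fun t => conjc (u t)) (conjc k).
Proof.
move=> [ur ui]; split.
  have E z : Re (conjc z) = Re z :> R by case: z.
  by under eq_fun do rewrite E; rewrite E.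
have E z : Im (conjc z) = - Im z :> R by case: z.
by under eq_fun do rewrite E; rewrite E; exact: cvgN.
Qed.

Lemma cvgc_norm u k : cvgc F u k -> nc (u t) @[t --> F] --> nc k.
Proof.
move=> /cvgc_lt uk; apply/cvgrPdist_lt => e /uk.
apply: filterS => t; apply: le_lt_trans.
rewrite ler_norml lerNl opprB le_nc_subl/=.
by rewrite ncBC le_nc_subl.
Qed.

Lemma cvgcV u k : k != 0 -> cvgc F u k -> cvgc F (fun t => (u t)^-1) k^-1.
Proof.
move=> k0 uk; rewrite invc_conj; under eq_fun do rewrite invc_conj.
apply: cvgcM; first exact: cvgc_conj.
apply: cvgc_real; apply: cvgV; first by rewrite sqrf_eq0 nc_eq0.
by rewrite expr2; under eq_fun do rewrite expr2; apply: cvgM; exact: cvgc_norm.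
Qed.

End filter.

Lemma cvgc_unique {T} (F : set_system T) {FF : ProperFilter F}
  (u : T -> R[i]) (k l : R[i]) : cvgc F u k -> cvgc F u l -> k = l.
Proof.
move=> [ur ui] [vr vi]; apply: Complex_eq.
  exact: (cvg_unique _ ur vr).
exact: (cvg_unique _ ui vi).
Qed.

Definition cnbhs (z : R[i]) : set_system R[i] :=
  [set A | exists2 d : R, 0 < d & forall w, nc (w - z) < d -> A w].

Global Instance cnbhs_filter z : ProperFilter (cnbhs z).
Proof.
split=> [[d d0 /(_ z)]|]; first by rewrite subrr nc0; exact.
split; first by exists 1.
- move=> P Q [d d0 dP] [e e0 eQ]; exists (Num.min d e).
    by rewrite lt_min d0.
  by move=> w; rewrite lt_min => /andP[wd we]; split; [exact: dP|exact: eQ].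
- by move=> P Q PQ [d d0 dP]; exists d => // w /dP /PQ.
Qed.

Definition ccont (f : R[i] -> R[i]) z := cvgc (cnbhs z) f (f z).

Lemma ccontP f z : ccont f z <-> forall e : R, 0 < e ->
  exists2 d : R, 0 < d & forall w, nc (w - z) < d -> nc (f w - f z) < e.
Proof. exact: cvgc_lt. Qed.

Lemma cvgc_comp {T} (F : set_system T) {FF : Filter F} (u : T -> R[i]) l f :
  ccont f l -> cvgc F u l -> cvgc F (fun t => f (u t)) (f l).
Proof.
move=> /ccontP fl /cvgc_lt ul; apply/cvgc_lt => e /fl[d d0 df].
by apply: filterS (ul d d0) => t; exact: df.
Qed.

Lemma ccont_comp f g z : ccont g (f z) -> ccont f z ->
  ccont (fun w => g (f w)) z.
Proof. exact: cvgc_comp. Qed.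

Lemma ccont_id z : ccont id z.
Proof. by apply/ccontP => e e0; exists e. Qed.

Lemma ccont_cst (k z : R[i]) : ccont (fun=> k) z.
Proof. exact: cvgc_cst. Qed.

Lemma near_ccont f g z : (\forall w \near cnbhs z, f w = g w) ->
  ccont f z -> ccont g z.
Proof.
move=> fg /cvgc_lt fz; have fgz : f z = g z.
  by case: fg => d d0; apply; rewrite subrr nc0.
apply/cvgc_lt => e /fz; apply: filterS2 fg => w ->.
by rewrite fgz.
Qed.

Definition pcont (p : R -> R[i]) (t : R) := cvgc (nbhs t) p (p t).

End complex_limits.

(** * Integrals over a segment *)

Section real_integral.
Context {R : realType}.
Notation mu := (@lebesgue_measure R).
Implicit Types (f g v : R -> R) (a b c : R).

Definition rint f a b : R := \int[mu]_(x in `[a, b]) f x.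

Definition cont_on f a b := forall t, a <= t <= b -> {for t, continuous f}.

Lemma cont_onW f a b c d : a <= c -> d <= b -> cont_on f a b -> cont_on f c d.
Proof.
by move=> ac db fab t /andP[ct td]; apply: fab; rewrite (le_trans ac)// (le_trans td).
Qed.

Lemma cont_on_integrable f a b : cont_on f a b -> mu.-integrable `[a, b] (EFin \o f).
Proof.
move=> fab; apply: continuous_compact_integrable; first exact: segment_compact.
apply: continuous_in_subspaceT => x /set_mem/=; rewrite in_itv/= => xab.
exact: fab.
Qed.

Lemma rintD f g a b : cont_on f a b -> cont_on g a b ->
  rint (fun t => f t + g t) a b = rint f a b + rint g a b.
Proof. by move=> cf cg; rewrite /rint RintegralD//; exact: cont_on_integrable. Qed.

Lemma rintB f g a b : cont_on f a b -> cont_on g a b ->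
  rint (fun t => f t - g t) a b = rint f a b - rint g a b.
Proof. by move=> cf cg; rewrite /rint RintegralB//; exact: cont_on_integrable. Qed.

Lemma rintZ k f a b : cont_on f a b -> rint (fun t => k * f t) a b = k * rint f a b.
Proof. by move=> cf; rewrite /rint RintegralZl//; exact: cont_on_integrable. Qed.

Lemma rint_cst k a b : a <= b -> rint (fun=> k) a b = k * (b - a).
Proof.
rewrite /rint Rintegral_cst//= le_eqVlt lebesgue_measure_itv/= lte_fin.
by move=> /predU1P[->|->//]; rewrite ltxx subrr.
Qed.

Lemma rint_cat f a b c : a <= c <= b -> cont_on f a b ->
  rint f a b = rint f a c + rint f c b.
Proof.
move=> /andP[ac cb] cf.
have := @Rintegral_itvB R f (BLeft a) (BRight b) c (cont_on_integrable cf).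
rewrite !bnd_simp => /(_ ac cb); rewrite Rintegral_itv_obnd_cbnd; last first.
  apply: integrableS (cont_on_integrable (cont_onW ac (lexx b) cf)) => //.
  exact: subset_itv_oc_cc.
by rewrite /rint => <-; rewrite addrC subrK.
Qed.

Lemma le_rint f g a b : cont_on f a b -> cont_on g a b ->
  (forall t, a <= t <= b -> f t <= g t) -> rint f a b <= rint g a b.
Proof.
by move=> cf cg fg; apply: le_Rintegral => //; exact: cont_on_integrable.
Qed.

Lemma rint_abs_le f v a b : cont_on f a b -> cont_on v a b ->
  (forall t, a <= t <= b -> `|f t| <= v t) -> `|rint f a b| <= rint v a b.
Proof.
move=> cf cv fv.
have cN : cont_on (fun t => -1 * f t) a b.
  by move=> t /cf ct; apply: cvgM => //; exact: cvg_cst.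
rewrite ler_norml lerNl; apply/andP; split.
  rewrite -mulN1r -rintZ//; apply: le_rint => // t /fv.
  by rewrite ler_norml mulN1r lerNl => /andP[].
by apply: le_rint => // t /fv; exact: le_trans (ler_norm _).
Qed.

Lemma eq_rint f g a b : (forall t, a <= t <= b -> f t = g t) -> rint f a b = rint g a b.
Proof.
by move=> fg; apply: eq_Rintegral => x /set_mem/=; rewrite in_itv; exact: fg.
Qed.

(** Needed for the integral of an affine function around a rectangle. *)
Lemma rint_id a b : a <= b -> rint id a b = (b ^+ 2 - a ^+ 2) / 2.
Proof.
rewrite le_eqVlt => /predU1P[->|ab].
  by rewrite /rint set_itv1 Rintegral_set1 subrr mul0r.
have df (x : R) : is_derive x 1 (fun x : R => x ^+ 2 / 2) x.
  apply: is_derive_eq => /=.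
  by rewrite !scaler0 add0r /GRing.scale/= mulr1; field.
have cF : continuous (fun x : R => x ^+ 2 / 2).
  by move=> x; apply: differentiable_continuous; apply/derivable1_diffP; case: (df x).
rewrite /rint /Rintegral (@continuous_FTC2 _ _ (fun x => x ^+ 2 / 2))//=.
- by rewrite mulrBl.
- have ci : continuous (@id R) by move=> y; exact: cvg_id.
  exact: continuous_subspaceT.
- split => //=; first exact/cvg_at_right_filter/cF.
  exact/cvg_at_left_filter/cF.
- by move=> x _; rewrite derive1E; case: (df x).
Qed.

End real_integral.

Section complex_integral.
Context {R : realType}.
Implicit Types (p q : R -> R[i]) (a b c : R).

Definition pcont_on p a b := forall t, a <= t <= b -> pcont p t.

Definition cint p a b : R[i] :=
  (rint (fun t => Re (p t)) a b) +i* (rint (fun t => Im (p t)) a b).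

Lemma pcont_on_Re p a b : pcont_on p a b -> cont_on (fun t => Re (p t)) a b.
Proof. by move=> cp t /cp[]. Qed.

Lemma pcont_on_Im p a b : pcont_on p a b -> cont_on (fun t => Im (p t)) a b.
Proof. by move=> cp t /cp[]. Qed.

Lemma pcont_on_cst k a b : pcont_on (fun=> k) a b.
Proof. by move=> t _; exact: cvgc_cst. Qed.

Lemma pcont_onB p q a b : pcont_on p a b -> pcont_on q a b -> pcont_on (fun t => p t - q t) a b.
Proof. by move=> cp cq t tab; apply: cvgcB; [exact: cp|exact: cq]. Qed.

Lemma pcont_onM p q a b : pcont_on p a b -> pcont_on q a b -> pcont_on (fun t => p t * q t) a b.
Proof. by move=> cp cq t tab; apply: cvgcM; [exact: cp|exact: cq]. Qed.

Lemma pcont_on_real (f : R -> R) a b : cont_on f a b -> pcont_on (fun t => (f t)%:C) a b.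
Proof. by move=> cf t tab; apply: cvgc_real; exact: cf. Qed.

Lemma eq_cint p q a b : (forall t, a <= t <= b -> p t = q t) -> cint p a b = cint q a b.
Proof. by move=> pq; congr (_ +i* _); apply: eq_rint => t /pq ->. Qed.

Lemma cintD p q a b : pcont_on p a b -> pcont_on q a b ->
  cint (fun t => p t + q t) a b = cint p a b + cint q a b.
Proof.
move=> cp cq; apply: Complex_eq => /=.
  rewrite -rintD; [|exact: pcont_on_Re..].
  by apply: eq_rint => t _; rewrite ReD.
rewrite -rintD; [|exact: pcont_on_Im..].
by apply: eq_rint => t _; rewrite ImD.
Qed.

Lemma cintZ k p a b : pcont_on p a b -> cint (fun t => k * p t) a b = k * cint p a b.
Proof.
move=> cp; have cr := pcont_on_Re cp; have ci := pcont_on_Im cp.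
have cz (l : R) (f : R -> R) : cont_on f a b -> cont_on (fun t => l * f t) a b.
  by move=> cf t /cf ct; apply: cvgM => //; exact: cvg_cst.
apply: Complex_eq; rewrite ?ReM ?ImM/= -!rintZ//.
  rewrite -rintB; [|exact: cz..].
  by apply: eq_rint => t _; rewrite ReM.
rewrite -rintD; [|exact: cz..].
by apply: eq_rint => t _; rewrite ImM.
Qed.

Lemma cintB p q a b : pcont_on p a b -> pcont_on q a b ->
  cint (fun t => p t - q t) a b = cint p a b - cint q a b.
Proof.
move=> cp cq; rewrite -mulN1r -cintZ// -cintD//; last first.
  by apply: pcont_onM => //; exact: pcont_on_cst.
by apply: eq_cint => t _; rewrite mulN1r.
Qed.

Lemma cint_conj p a b : pcont_on p a b -> cint (fun t => conjc (p t)) a b = conjc (cint p a b).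
Proof.
move=> cp; apply: Complex_eq => /=; first by apply: eq_rint => t _; case: (p t).
rewrite -mulN1r -rintZ; last exact: pcont_on_Im.
by apply: eq_rint => t _; rewrite mulN1r; case: (p t).
Qed.

Lemma cint_real (f : R -> R) a b : a <= b ->
  cint (fun t => (f t)%:C) a b = (rint f a b)%:C.
Proof. by move=> ab; apply: Complex_eq => //=; rewrite rint_cst// mul0r. Qed.

Lemma cint_cst k a b : a <= b -> cint (fun=> k) a b = k * (b - a)%:C.
Proof.
by move=> ab; apply: Complex_eq; rewrite ?ReM ?ImM/= rint_cst// mulr0 ?subr0 ?add0r.
Qed.

Lemma cint_id a b : a <= b -> cint (fun t => t%:C) a b = ((b ^+ 2 - a ^+ 2) / 2)%:C.
Proof. by move=> ab; rewrite cint_real// -rint_id. Qed.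

Lemma cint_cat p a b c : a <= c <= b -> pcont_on p a b ->
  cint p a b = cint p a c + cint p c b.
Proof.
move=> acb cp; apply: Complex_eq; rewrite ?ReD ?ImD; apply: rint_cat => //.
  exact: pcont_on_Re.
exact: pcont_on_Im.
Qed.

(** The factor 2 comes from bounding the two components separately. The sharp
constant would be 1, but only the order of magnitude of such bounds matters
below. *)
Lemma cint_le p (v : R -> R) a b : pcont_on p a b -> cont_on v a b ->
  (forall t, a <= t <= b -> nc (p t) <= v t) -> nc (cint p a b) <= 2 * rint v a b.
Proof.
move=> cp cv pv; apply: le_trans (nc_le_ReIm _) _; rewrite mulr_natl mulr2n/=.
apply: lerD; apply: rint_abs_le => //; try exact: pcont_on_Re; try exact: pcont_on_Im.
  by move=> t /pv; apply: le_trans; exact: norm_Re_le.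
by move=> t /pv; apply: le_trans; exact: norm_Im_le.
Qed.

Lemma cint_le_cst p M a b : a <= b -> pcont_on p a b ->
  (forall t, a <= t <= b -> nc (p t) <= M) -> nc (cint p a b) <= 2 * M * (b - a).
Proof.
move=> ab cp pM; rewrite -mulrA -rint_cst//.
by apply: cint_le => // t _; exact: cvg_cst.
Qed.

End complex_integral.

(** * Complex differentiability *)

Section complex_derivative.
Context {R : realType}.
Implicit Types (f g : R[i] -> R[i]) (z w : R[i]).

(** Caratheodory's form of the derivative: [phi z] is the derivative. It makes
the rules for sums, products, inverses and composites algebraic identities,
and [phi] itself is the difference quotient extended to [z], the function to
which the mean value property is applied in [cauchy_formula]. *)
Definition cdif f z :=
  exists2 phi, ccont phi z & forall w, f w = f z + phi w * (w - z).

Lemma cdif_ccont f z : cdif f z -> ccont f z.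
Proof.
move=> [phi cphi fE]; rewrite /ccont [X in cvgc _ X _](funext fE).
rewrite -[X in cvgc _ _ X]addr0 -(mulr0 (phi z)) -(subrr z).
apply: cvgcD; first exact: cvgc_cst.
apply: cvgcM => //; apply: cvgcB; [exact: ccont_id|exact: cvgc_cst].
Qed.

Lemma cdif_cst (k : R[i]) z : cdif (fun=> k) z.
Proof.
exists (fun=> 0); first exact: ccont_cst.
by move=> w; rewrite mul0r addr0.
Qed.

Lemma cdif_id z : cdif id z.
Proof.
exists (fun=> 1); first exact: ccont_cst.
by move=> w; rewrite mul1r addrC subrK.
Qed.

Lemma cdifD f g z : cdif f z -> cdif g z -> cdif (fun w => f w + g w) z.
Proof.
move=> [p cp fE] [q cq gE]; exists (fun w => p w + q w); first exact: cvgcD.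
by move=> w; rewrite fE gE; ring.
Qed.

Lemma cdifM f g z : cdif f z -> cdif g z -> cdif (fun w => f w * g w) z.
Proof.
move=> df dg; have cg := cdif_ccont dg.
case: df dg => [p cp fE] [q cq gE].
exists (fun w => p w * g w + f z * q w).
  by apply: cvgcD; apply: cvgcM => //; exact: cvgc_cst.
by move=> w; rewrite fE gE; ring.
Qed.

Lemma cdifB f g z : cdif f z -> cdif g z -> cdif (fun w => f w - g w) z.
Proof.
move=> df dg; under eq_fun do rewrite -mulN1r.
by apply: cdifD => //; apply: cdifM => //; exact: cdif_cst.
Qed.

Lemma cdif_comp f g z : cdif g (f z) -> cdif f z -> cdif (fun w => g (f w)) z.
Proof.
move=> [q cq gE] df; have cf := cdif_ccont df; case: df => [p cp fE].
exists (fun w => q (f w) * p w).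
  by apply: cvgcM => //; exact: (ccont_comp cq cf).
by move=> w; rewrite [LHS]gE -mulrA; congr (_ + _ * _); rewrite fE addrC addKr.
Qed.

Lemma ccont_near_neq0 f z : ccont f z -> f z != 0 ->
  \forall w \near cnbhs z, f w != 0.
Proof.
move=> /cvgc_lt cf; rewrite -nc_gt0 => /cf; apply: filterS => w.
by apply: contraTneq => ->; rewrite sub0r ncN ltxx.
Qed.

(** The witness for [g] is its difference quotient, which agrees near [z] with
the one of [f]. *)
Lemma near_cdif f g z : (\forall w \near cnbhs z, f w = g w) ->
  cdif f z -> cdif g z.
Proof.
move=> fg [p cp fE]; have fgz : f z = g z.
  by case: fg => d d0; apply; rewrite subrr nc0.
exists (fun w => if w == z then p z else (g w - g z) / (w - z)).
  apply: near_ccont cp; apply: filterS fg => w fgw.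
  have [->//|wz] := eqVneq w z.
  by rewrite -fgw -fgz fE addrAC subrr add0r mulfK// subr_eq0.
move=> w; have [->|wz] := eqVneq w z; first by rewrite subrr mulr0 addr0.
by rewrite divfK ?subr_eq0// addrC subrK.
Qed.

Lemma cdif_inv z : z != 0 -> cdif (fun w => w^-1) z.
Proof.
move=> z0; pose g w := z^-1 + - (w^-1 * z^-1) * (w - z).
have gz : g z = z^-1 by rewrite /g subrr mulr0 addr0.
apply: (@near_cdif g).
  apply: filterS (ccont_near_neq0 (@ccont_id R z) z0) => w w0.
  by rewrite /g; field; rewrite z0 w0.
exists (fun w => - (w^-1 * z^-1)); last by move=> w; rewrite gz.
apply: cvgcN; apply: cvgcM; last exact: cvgc_cst.
exact: (cvgcV z0 (@ccont_id R z)).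
Qed.

Lemma cdifV f z : f z != 0 -> cdif f z -> cdif (fun w => (f w)^-1) z.
Proof. by move=> fz df; apply: cdif_comp df; exact: cdif_inv. Qed.

Lemma cdif_prod n (f : nat -> R[i] -> R[i]) z : (forall i, (i < n)%N -> cdif (f i) z) ->
  cdif (fun w => \prod_(i < n) f i w) z.
Proof.
elim: n => [_|n ih df].
  by under eq_fun do rewrite big_ord0; exact: cdif_cst.
under eq_fun do rewrite big_ord_recr/=.
by apply: cdifM; [apply: ih => i /ltnW; exact: df|exact: df].
Qed.

Lemma cdifP f z : cdif f z <-> exists l, forall e : R, 0 < e ->
  \forall w \near cnbhs z, nc (f w - (f z + l * (w - z))) <= e * nc (w - z).
Proof.
split=> [[p /cvgc_lt cp fE]|[l fl]].
  exists (p z) => e /cp; apply: filterS => w pw.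
  rewrite fE (_ : _ - _ = (p w - p z) * (w - z)); last by ring.
  by rewrite ncM ler_wpM2r ?nc_ge0// ltW.
exists (fun w => if w == z then l else (f w - f z) / (w - z)); last first.
  move=> w; have [->|wz] := eqVneq w z; first by rewrite subrr mulr0 addr0.
  by rewrite divfK ?subr_eq0// addrC subrK.
apply/cvgc_lt => e e0; rewrite eqxx.
have e20 : 0 < e / 2 by rewrite divr_gt0.
apply: filterS (fl _ e20) => w.
have [->|wz] := eqVneq w z; first by move=> _; rewrite subrr nc0.
move=> fw; rewrite (_ : _ - l = (f w - (f z + l * (w - z))) / (w - z)); last first.
  by field; rewrite subr_eq0.
rewrite ncM ncV ltr_pdivrMr ?nc_gt0 ?subr_eq0//.
apply: le_lt_trans fw _.
by rewrite ltr_pM2r ?nc_gt0 ?subr_eq0// ltr_pdivrMr// ltr_pMr// ltr1n.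
Qed.

End complex_derivative.

(** * Goursat's theorem on rectangles *)

Section goursat.
Context {R : realType}.
Implicit Types (F G : R[i] -> R[i]) (x y : R).

Definition in_rect x0 x1 y0 y1 (w : R[i]) := (x0 <= Re w <= x1) && (y0 <= Im w <= y1).

(** The contour integral of [F dz] around the rectangle, counterclockwise. *)
Definition rect_loop F x0 x1 y0 y1 : R[i] :=
  cint (fun x => F (x +i* y0)) x0 x1 - cint (fun x => F (x +i* y1)) x0 x1 +
  'i%C * (cint (fun y => F (x1 +i* y)) y0 y1 - cint (fun y => F (x0 +i* y)) y0 y1).

Definition cont_rect F x0 x1 y0 y1 := forall w, in_rect x0 x1 y0 y1 w -> ccont F w.

Lemma cont_rect_h F x0 x1 y0 y1 y : cont_rect F x0 x1 y0 y1 -> y0 <= y <= y1 ->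
  pcont_on (fun x => F (x +i* y)) x0 x1.
Proof.
move=> cF yy t tx; apply: (@cvgc_comp _ _ _ _ (fun x => x +i* y)).
  by apply: cF; rewrite /in_rect/= tx.
by split => //=; exact: cvg_cst.
Qed.

Lemma cont_rect_v F x0 x1 y0 y1 x : cont_rect F x0 x1 y0 y1 -> x0 <= x <= x1 ->
  pcont_on (fun y => F (x +i* y)) y0 y1.
Proof.
move=> cF xx t ty; apply: (@cvgc_comp _ _ _ _ (fun y => x +i* y)).
  by apply: cF; rewrite /in_rect/= ty xx.
by split => //=; exact: cvg_cst.
Qed.

(** An affine function has a polynomial primitive; here the four integrals are
evaluated explicitly. *)
Lemma rect_loop_affine (k l : R[i]) x0 x1 y0 y1 : x0 <= x1 -> y0 <= y1 ->
  rect_loop (fun w => k + l * w) x0 x1 y0 y1 = 0.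
Proof.
move=> xx yy; rewrite /rect_loop.
have cid a b : pcont_on (fun t : R => t%:C) a b by apply: pcont_on_real => t _; exact: cvg_id.
have h y : cint (fun x => k + l * (x +i* y)) x0 x1 =
    (k + l * (0 +i* y)) * (x1 - x0)%:C + l * ((x1 ^+ 2 - x0 ^+ 2) / 2)%:C.
  rewrite -cint_cst// -cint_id// -cintZ// -cintD; last 2 first.
  - exact: pcont_on_cst.
  - by apply: pcont_onM => //; exact: pcont_on_cst.
  apply: eq_cint => t _; rewrite -addrA -mulrDr; congr (_ + _ * _).
  by apply: Complex_eq => /=; ring.
have v x : cint (fun y => k + l * (x +i* y)) y0 y1 =
    (k + l * x%:C) * (y1 - y0)%:C + l * 'i%C * ((y1 ^+ 2 - y0 ^+ 2) / 2)%:C.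
  rewrite -cint_cst// -cint_id// -cintZ// -cintD; last 2 first.
  - exact: pcont_on_cst.
  - by apply: pcont_onM => //; exact: pcont_on_cst.
  apply: eq_cint => t _; rewrite -addrA -mulrA -mulrDr; congr (_ + _ * _).
  by apply: Complex_eq => /=; ring.
rewrite !h !v; case: k l {h v} => a b [c d].
by apply: Complex_eq => /=; field.
Qed.

Lemma rect_loop_B F G x0 x1 y0 y1 : x0 <= x1 -> y0 <= y1 ->
  cont_rect F x0 x1 y0 y1 -> cont_rect G x0 x1 y0 y1 ->
  rect_loop (fun w => F w - G w) x0 x1 y0 y1 = rect_loop F x0 x1 y0 y1 - rect_loop G x0 x1 y0 y1.
Proof.
move=> xx yy cF cG; rewrite /rect_loop !cintB; last first;
  try (apply: cont_rect_h; [eassumption|by rewrite ?lexx ?xx ?yy]);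
  try (apply: cont_rect_v; [eassumption|by rewrite ?lexx ?xx ?yy]).
by ring.
Qed.

Lemma rect_loop_le F M x0 x1 y0 y1 : x0 <= x1 -> y0 <= y1 -> cont_rect F x0 x1 y0 y1 ->
  (forall w, in_rect x0 x1 y0 y1 w -> nc (F w) <= M) ->
  nc (rect_loop F x0 x1 y0 y1) <= 4 * M * (x1 - x0 + (y1 - y0)).
Proof.
move=> xx yy cF FM.
have h y : y0 <= y <= y1 -> nc (cint (fun x => F (x +i* y)) x0 x1) <= 2 * M * (x1 - x0).
  move=> y01; apply: cint_le_cst => //; first exact: cont_rect_h cF _.
  by move=> t tx; apply: FM; rewrite /in_rect/= tx.
have v x : x0 <= x <= x1 -> nc (cint (fun y => F (x +i* y)) y0 y1) <= 2 * M * (y1 - y0).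
  move=> x01; apply: cint_le_cst => //; first exact: cont_rect_v cF _.
  by move=> t ty; apply: FM; rewrite /in_rect/= ty x01.
apply: le_trans (le_ncD _ _) _; rewrite ncM.
have -> : nc ('i%C : R[i]) = 1 by rewrite /nc expr0n/= add0r expr1n sqrtr1.
rewrite mul1r.
have h0 : nc (cint (fun x => F (x +i* y0)) x0 x1) <= 2 * M * (x1 - x0).
  by apply: h; rewrite lexx.
have h1 : nc (cint (fun x => F (x +i* y1)) x0 x1) <= 2 * M * (x1 - x0).
  by apply: h; rewrite lexx andbT.
have v0 : nc (cint (fun y => F (x0 +i* y)) y0 y1) <= 2 * M * (y1 - y0).
  by apply: v; rewrite lexx.
have v1 : nc (cint (fun y => F (x1 +i* y)) y0 y1) <= 2 * M * (y1 - y0).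
  by apply: v; rewrite lexx andbT.
apply: le_trans (lerD (le_ncB _ _) (le_ncB _ _)) _; lra.
Qed.

Lemma rect_loop_split_x F x0 x x1 y0 y1 : x0 <= x <= x1 -> y0 <= y1 ->
  cont_rect F x0 x1 y0 y1 ->
  rect_loop F x0 x1 y0 y1 = rect_loop F x0 x y0 y1 + rect_loop F x x1 y0 y1.
Proof.
move=> xx yy cF; rewrite /rect_loop.
rewrite (cint_cat xx); last by apply: cont_rect_h cF _; rewrite lexx.
rewrite (@cint_cat _ (fun x => F (x +i* y1)) x0 x1 x)//; last first.
  by apply: cont_rect_h cF _; rewrite lexx andbT.
by ring.
Qed.

Lemma rect_loop_split_y F x0 x1 y0 y y1 : x0 <= x1 -> y0 <= y <= y1 ->
  cont_rect F x0 x1 y0 y1 ->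
  rect_loop F x0 x1 y0 y1 = rect_loop F x0 x1 y0 y + rect_loop F x0 x1 y y1.
Proof.
move=> xx yy cF; rewrite /rect_loop.
rewrite (cint_cat yy); last by apply: cont_rect_v cF _; rewrite lexx andbT.
rewrite (@cint_cat _ (fun y => F (x0 +i* y)) y0 y1 y)//; last first.
  by apply: cont_rect_v cF _; rewrite lexx.
by ring.
Qed.

End goursat.

Section goursat_theorem.
Context {R : realType}.
Implicit Types (F : R[i] -> R[i]) (x y : R).

Lemma in_rectW x0 x1 y0 y1 a0 a1 b0 b1 (w : R[i]) :
  x0 <= a0 -> a1 <= x1 -> y0 <= b0 -> b1 <= y1 ->
  in_rect a0 a1 b0 b1 w -> in_rect x0 x1 y0 y1 w.
Proof.
move=> ? ? ? ? /andP[/andP[? ?] /andP[? ?]]; rewrite /in_rect.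
by do !(apply/andP; split); lra.
Qed.

(** The integral around a rectangle is the sum of the integrals around its four
quarters, so one of them carries at least a quarter of it. *)
Lemma rect_loop_quarter F x y h k : 0 <= h -> 0 <= k ->
  cont_rect F x (x + h) y (y + k) ->
  exists p : R * R, [/\ x <= p.1, p.1 + h / 2 <= x + h, y <= p.2,
    p.2 + k / 2 <= y + k &
    nc (rect_loop F x (x + h) y (y + k)) <=
      4 * nc (rect_loop F p.1 (p.1 + h / 2) p.2 (p.2 + k / 2))].
Proof.
move=> h0 k0 cF.
pose D a b := rect_loop F a (a + h / 2) b (b + k / 2).
have sub a0 a1 b0 b1 : x <= a0 -> a1 <= x + h -> y <= b0 -> b1 <= y + k ->
    cont_rect F a0 a1 b0 b1.
  by move=> *; move=> w wr; apply: cF; apply: in_rectW wr.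
have E : rect_loop F x (x + h) y (y + k) =
    D x y + D x (y + k / 2) + (D (x + h / 2) y + D (x + h / 2) (y + k / 2)).
  rewrite (@rect_loop_split_x _ _ _ (x + h / 2)); [|lra|lra|exact: cF].
  rewrite (@rect_loop_split_y _ _ _ _ _ (y + k / 2)); [|lra|lra|apply: sub; lra].
  rewrite (@rect_loop_split_y _ _ (x + h / 2) _ _ (y + k / 2)); [|lra|lra|apply: sub; lra].
  rewrite /D (_ : x + h / 2 + h / 2 = x + h); last by lra.
  by rewrite (_ : y + k / 2 + k / 2 = y + k); last by lra.
apply: contrapT => /forallNP H.
have small a b : (a == x) || (a == x + h / 2) -> (b == y) || (b == y + k / 2) ->
    4 * nc (D a b) < nc (rect_loop F x (x + h) y (y + k)).
  move=> ax yb; rewrite ltNge; apply/negP => le; apply: (H (a, b)).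
  by case/orP: ax le => /eqP->; case/orP: yb => /eqP-> le; split => //=; lra.
have s1 := small x y; have s2 := small x (y + k / 2).
have s3 := small (x + h / 2) y; have s4 := small (x + h / 2) (y + k / 2).
move: s1 s2 s3 s4; rewrite !eqxx/= !orbT => /(_ isT isT) s1 /(_ isT isT) s2.
move=> /(_ isT isT) s3 /(_ isT isT) s4.
have := le_ncD (D x y + D x (y + k / 2)) (D (x + h / 2) y + D (x + h / 2) (y + k / 2)).
have := le_ncD (D x y) (D x (y + k / 2)).
have := le_ncD (D (x + h / 2) y) (D (x + h / 2) (y + k / 2)).
rewrite -E => t1 t2 t3.
suff : nc (rect_loop F x (x + h) y (y + k)) < nc (rect_loop F x (x + h) y (y + k)) by rewrite ltxx.
by lra.
Qed.

(** Bisection: if the integral were not 0, nested rectangles would shrink to a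
point near which [F] is affine up to an error that is too small to produce
their integrals. *)
Lemma goursat F x0 x1 y0 y1 : x0 <= x1 -> y0 <= y1 ->
  (forall w, in_rect x0 x1 y0 y1 w -> cdif F w) -> rect_loop F x0 x1 y0 y1 = 0.
Proof.
move=> xx yy dF.
pose h := x1 - x0; pose k := y1 - y0.
have h0 : 0 <= h by rewrite subr_ge0.
have k0 : 0 <= k by rewrite subr_ge0.
pose hn n : R := h / 2 ^+ n; pose kn n : R := k / 2 ^+ n.
have p2 n : 0 < 2 ^+ n :> R by rewrite exprn_gt0.
have hn0 n : 0 <= hn n by rewrite divr_ge0// ltW.
have kn0 n : 0 <= kn n by rewrite divr_ge0// ltW.
have hS n : hn n.+1 = hn n / 2 by rewrite /hn exprSr invfM mulrA.
have kS n : kn n.+1 = kn n / 2 by rewrite /kn exprSr invfM mulrA.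
have cF : cont_rect F x0 x1 y0 y1 by move=> w /dF; exact: cdif_ccont.
(* [s n], below, is the lower left corner of the [n]-th rectangle. *)
pose good n (p : R * R) :=
  [/\ x0 <= p.1, p.1 + hn n <= x1, y0 <= p.2 & p.2 + kn n <= y1].
pose D n (p : R * R) := rect_loop F p.1 (p.1 + hn n) p.2 (p.2 + kn n).
have /choice[next nextP] : forall np : nat * (R * R), exists q : R * R,
    good np.1 np.2 -> [/\ np.2.1 <= q.1, q.1 + hn np.1.+1 <= np.2.1 + hn np.1,
      np.2.2 <= q.2, q.2 + kn np.1.+1 <= np.2.2 + kn np.1 &
      nc (D np.1 np.2) <= 4 * nc (D np.1.+1 q)].
  move=> [n p]/=; have [[g1 g2 g3 g4]|ng] := pselect (good n p); last by exists p.
  have [|q [q1 q2 q3 q4 q5]] := @rect_loop_quarter F p.1 p.2 _ _ (hn0 n) (kn0 n).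
    by move=> w wr; apply: cF; apply: in_rectW wr.
  by exists q => _; rewrite /D hS kS; split.
pose s := fix s n := if n is m.+1 then next (m, s m) else (x0, y0).
have sg n : good n (s n).
  elim: n => [|n ih].
    by split; rewrite /= ?lexx// /hn /kn expr0 divr1 /h /k addrC subrK.
  have [? ? ? ? _] := nextP (n, s n) ih; case: ih => ? ? ? ?.
  by split; apply: le_trans; eassumption.
have sP n := nextP (n, s n) (sg n).
have mx n m : (n <= m)%N -> (s n).1 <= (s m).1 /\ (s m).1 + hn m <= (s n).1 + hn n.
  elim: m => [|m ih]; first by rewrite leqn0 => /eqP ->.
  rewrite leq_eqVlt => /predU1P[->//|]; rewrite ltnS => /ih[? ?].
  have [/= ? ? _ _ _] := sP m.
  by split; apply: le_trans; eassumption.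
have my n m : (n <= m)%N -> (s n).2 <= (s m).2 /\ (s m).2 + kn m <= (s n).2 + kn n.
  elim: m => [|m ih]; first by rewrite leqn0 => /eqP ->.
  rewrite leq_eqVlt => /predU1P[->//|]; rewrite ltnS => /ih[? ?].
  have [/= _ _ ? ? _] := sP m.
  by split; apply: le_trans; eassumption.
have nested (u : nat -> R) (l : nat -> R) : (forall n, 0 <= l n) ->
    (forall n m, (n <= m)%N -> u n <= u m /\ u m + l m <= u n + l n) ->
    exists p, forall n, u n <= p <= u n + l n.
  move=> l0 ul; have ub n m : u m <= u n + l n.
    have [nm|/ltnW mn] := leqP n m.
      by have [_] := ul _ _ nm; apply: le_trans; rewrite lerDl.
    by have [+ _] := ul _ _ mn => /le_trans; apply; rewrite lerDl.
  exists (sup (range u)) => n; apply/andP; split.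
    by apply: ub_le_sup; [exists (u n + l n) => _ [m _ <-]|exists n].
  by apply: ge_sup; [exists (u 0%N), 0%N|move=> _ [m _ <-]].
have [px pxP] := nested _ _ hn0 mx; have [py pyP] := nested _ _ kn0 my.
pose p := px +i* py.
have Dn n : nc (D 0%N (s 0%N)) <= 4 ^+ n * nc (D n (s n)).
  elim: n => [|n ih]; first by rewrite expr0 mul1r.
  apply: le_trans ih _; rewrite exprSr -mulrA ler_wpM2l ?exprn_ge0//.
  by have [] := sP n.
have D0 : rect_loop F x0 x1 y0 y1 = D 0%N (s 0%N).
  by rewrite /D /= /hn /kn expr0 !divr1 /h /k ![_ + (_ - _)]addrC !subrK.
have rp : in_rect x0 x1 y0 y1 p.
  have := pxP 0%N; have := pyP 0%N; rewrite /= /hn /kn expr0 !divr1 /h /k.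
  by rewrite ![_ + (_ - _)]addrC !subrK /in_rect/= => -> ->.
have [l pl] := (cdifP F p).1 (dF p rp).
rewrite D0; apply/eqP; rewrite -nc_eq0 eq_le nc_ge0 andbT.
apply/ler_addgt0Pr => e e0; rewrite add0r.
(* At scale [n] the half-perimeter is [(h + k) / 2 ^+ n] and the error of the
   affine approximation is at most [e / c] times that, so the integral
   multiplied by [4 ^+ n] is at most [4 * (h + k) ^+ 2 * (e / c) <= e]. *)
pose c : R := 4 * (h + k) ^+ 2 + 1.
have c0 : 0 < c by rewrite ltr_wpDl// mulr_ge0// sqr_ge0.
have [d d0 dP] := pl (e / c) (divr_gt0 e0 c0).
have [n hkn] : exists n, (h + k) / 2 ^+ n < d.
  have := @cvg_geometric R (h + k) 2^-1; rewrite ger0_norm// invf_lt1// ltr1n.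
  move=> /(_ isT) /cvgr0Pnorm_lt /(_ d d0) [n _ /(_ n (leqnn n))].
  rewrite /geometric/= exprVn ger0_norm; first by exists n.
  by apply: divr_ge0; [exact: addr_ge0|exact: ltW].
apply: le_trans (Dn n) _.
pose A w := F p + l * (w - p).
have inr w : in_rect (s n).1 ((s n).1 + hn n) (s n).2 ((s n).2 + kn n) w ->
    nc (w - p) <= hn n + kn n.
  move=> /andP[/andP[? ?] /andP[? ?]].
  have /andP[? ?] := pxP n; have /andP[? ?] := pyP n.
  apply: le_trans (nc_le_ReIm _) _; rewrite ReB ImB /p/=.
  by apply: lerD; rewrite ler_norml; apply/andP; split; lra.
have cFn : cont_rect F (s n).1 ((s n).1 + hn n) (s n).2 ((s n).2 + kn n).
  by have [? ? ? ?] := sg n; move=> w wr; apply: cF; apply: in_rectW wr.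
have cA (a0 a1 b0 b1 : R) : cont_rect A a0 a1 b0 b1.
  move=> w _; apply: cvgcD; first exact: cvgc_cst.
  apply: cvgcM; first exact: cvgc_cst.
  by apply: cvgcB; [exact: ccont_id|exact: cvgc_cst].
have lx : (s n).1 <= (s n).1 + hn n by rewrite lerDl.
have ly : (s n).2 <= (s n).2 + kn n by rewrite lerDl.
have DE : D n (s n) = rect_loop (fun w => F w - A w) (s n).1 ((s n).1 + hn n) (s n).2 ((s n).2 + kn n).
  rewrite rect_loop_B//.
  have -> : A = (fun w => (F p - l * p) + l * w).
    by apply: funext => w; rewrite /A; ring.
  by rewrite rect_loop_affine// subr0.
have cFA : cont_rect (fun w => F w - A w) (s n).1 ((s n).1 + hn n) (s n).2 ((s n).2 + kn n).
  by move=> w wr; apply: cvgcB; [exact: cFn|exact: cA wr].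
have hk : hn n + kn n = (h + k) / 2 ^+ n by rewrite /hn /kn -mulrDl.
have FAle w : in_rect (s n).1 ((s n).1 + hn n) (s n).2 ((s n).2 + kn n) w ->
    nc (F w - A w) <= e / c * (hn n + kn n).
  move=> wr; apply: le_trans (dP w _) _.
    by apply: le_lt_trans (inr _ wr) _; rewrite hk.
  by rewrite ler_wpM2l ?inr// divr_ge0// ltW.
have := rect_loop_le lx ly cFA FAle; rewrite -DE => le.
have {}le : nc (D n (s n)) <= 4 * (e / c * (hn n + kn n)) * (hn n + kn n).
  by apply: le_trans le _; rewrite ![_ + _ - _]addrAC !subrr !add0r.
have q4 : 4 ^+ n * ((h + k) / 2 ^+ n) ^+ 2 = (h + k) ^+ 2 :> R.
  have -> : (4 : R) = 2 * 2 by lra.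
  by rewrite exprMn; field; rewrite gt_eqF.
have le4 : 4 ^+ n * nc (D n (s n)) <= 4 ^+ n * (4 * (e / c * (hn n + kn n)) * (hn n + kn n)).
  by rewrite ler_wpM2l// exprn_ge0.
apply: le_trans le4 _; rewrite hk.
rewrite (_ : _ * _ = e * (4 * (4 ^+ n * ((h + k) / 2 ^+ n) ^+ 2) / c)); last by ring.
by rewrite q4 ler_piMr ?ltW// ltr_pdivrMr// mul1r /c ltrDl.
Qed.

End goursat_theorem.

(** * The complex exponential *)

Section cexp.
Context {R : realType}.
Implicit Types (x y t : R) (z w : R[i]).

Lemma is_derive_approx (f : R -> R) x l : is_derive x 1 f l ->
  forall e : R, 0 < e -> \forall h \near (0 : R), `|f (x + h) - f x - l * h| <= e * `|h|.
Proof.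
move=> [df fl] e e0.
have : h^-1 *: (f (h *: 1 + x) - f x) @[h --> (0 : R)^'] --> l.
  by move: df => /cvg_ex[/= l' h']; rewrite -fl /derive (cvg_lim _ h').
move/cvgrPdist_lt => /(_ e e0) [d /= d0 dP]; exists d => //= h hd.
have [->|h0] := eqVneq h 0; first by rewrite addr0 mulr0 subrr subr0 normr0 mulr0.
have := dP h hd h0; rewrite /GRing.scale/= mulr1 (addrC h) => hlt.
rewrite (_ : _ - _ = - (l - h^-1 * (f (x + h) - f x)) * h); last by field.
by rewrite normrM normrN ler_wpM2r// ltW.
Qed.

Definition expi t : R[i] := cos t +i* sin t.

Lemma expiD x y : expi (x + y) = expi x * expi y.
Proof.
by apply: Complex_eq; rewrite ?ReM ?ImM/= ?cosD ?sinD//; ring.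
Qed.

Lemma expi0 : expi 0 = 1.
Proof. by rewrite /expi cos0 sin0. Qed.

Lemma nc_expi t : nc (expi t) = 1.
Proof. by rewrite /nc/= cos2Dsin2 sqrtr1. Qed.

Lemma expi_2pi : expi (2 * pi) = 1.
Proof.
by rewrite /expi mulr_natl cos2pi sin2pi.
Qed.

Definition cexp z : R[i] := (expR (Re z))%:C * expi (Im z).

Lemma cexpD z w : cexp (z + w) = cexp z * cexp w.
Proof. by rewrite /cexp ReD ImD expRD expiD rmorphM/=; ring. Qed.

Lemma nc_cexp z : nc (cexp z) = expR (Re z).
Proof. by rewrite ncM nc_real nc_expi mulr1 ger0_norm// expR_ge0. Qed.

Lemma cexp_ReIm z : cexp z = (expR (Re z) * cos (Im z)) +i* (expR (Re z) * sin (Im z)).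
Proof. by apply: Complex_eq; rewrite ?ReM ?ImM/= mul0r ?subr0 ?addr0. Qed.

Lemma near0_cnbhs (P Q : R -> Prop) : (\forall h \near (0 : R), P h) ->
  (\forall h \near (0 : R), Q h) ->
  \forall w \near cnbhs (0 : R[i]), P (Re w) /\ Q (Im w).
Proof.
move=> [d/= d0 dP] [e/= e0 eP]; exists (Num.min d e); first by rewrite lt_min d0.
move=> w; rewrite subr0 lt_min => /andP[wd we]; split.
  by apply: dP; rewrite /= sub0r normrN; exact: le_lt_trans (norm_Re_le _) wd.
by apply: eP; rewrite /= sub0r normrN; exact: le_lt_trans (norm_Im_le _) we.
Qed.

(** The estimates of order one at 0 of [expR], [cos] and [sin] combine into one
for [cexp]; the law of exponents then transports it to every point in
[cdif_cexp]. *)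
Lemma cdif_cexp0 : cdif cexp 0.
Proof.
apply/cdifP; exists 1 => e e0.
have e40 : 0 < Num.min (e / 8) 1 by rewrite lt_min ltr01 divr_gt0.
have hexp := is_derive_approx (is_derive_expR (0 : R)) e40.
have hsin := is_derive_approx (is_derive_sin (0 : R)) e40.
have hcos := is_derive_approx (is_derive_cos (0 : R)) e40.
have small : \forall h \near (0 : R), `|h| < Num.min (e / 8) (1 / 2).
  by apply: (@nbhs0_lt R R); rewrite lt_min !divr_gt0.
apply: filterS (near0_cnbhs (filterI hexp small) (filterI hsin hcos)).
move=> w [[ex wx] [sy cy]].
have -> : cexp 0 = 1 :> R[i] by rewrite /cexp/= expR0 expi0 mulr1.
rewrite cexp_ReIm.
move: ex sy cy; rewrite !add0r expR0 sin0 cos0 oppr0 mul0r !subr0 !mul1r addr0.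
move: wx e40; rewrite !lt_min => /andP[wx1 wx2] /andP[e80 _].
have [m1 m2] : Num.min (e / 8) 1 <= e / 8 /\ Num.min (e / 8) 1 <= 1.
  by split; rewrite ge_min lexx ?orbT.
have m0 : 0 < Num.min (e / 8) 1 by rewrite lt_min e80 ltr01.
move: (Num.min (e / 8) 1) m0 m1 m2 => m m0 m1 m2.
have := norm_Re_le w; have := norm_Im_le w; have := nc_ge0 w.
move: (nc w) => n; case: w wx1 wx2 => x y /= wx1 wx2 n0 yn xn ex sy cy.
set E := expR x in ex *; set c := cos y in cy *; set s := sin y in sy *.
have E2 : E <= 2.
  have hx := ler_norm (E - 1 - x); have := ler_norm x; have := normr_ge0 x.
  have : m * `|x| <= 1 * `|x| by rewrite ler_wpM2r.
  lra.
have E0 : 0 < E by exact: expR_gt0.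
have E1 : `|E - 1| <= 2 * `|x|.
  have -> : E - 1 = (E - 1 - x) + x by ring.
  have mx : m * `|x| <= 1 * `|x| by rewrite ler_wpM2r.
  by apply: le_trans (ler_normD _ _) _; lra.
apply: le_trans (nc_le_ReIm _) _ => /=.
have -> : E * c - (1 + x) =
  (E - 1 - x) + E * (c - 1) by ring.
have -> : E * s - (0 + y) =
  E * (s - y) + (E - 1) * y by ring.
have r : `|E - 1 - x + E * (c - 1)| <= m * n + 2 * (m * n).
  apply: le_trans (ler_normD _ _) _; rewrite normrM (gtr0_norm E0).
  apply: lerD; first by apply: le_trans ex _; rewrite ler_wpM2l// ltW.
  apply: ler_pM => //; first exact: ltW.
  by apply: le_trans cy _; rewrite ler_wpM2l// ltW.
have i : `|E * (s - y) + (E - 1) * y| <= 2 * (m * n) + e / 4 * n.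
  apply: le_trans (ler_normD _ _) _; rewrite !normrM (gtr0_norm E0).
  apply: lerD.
    apply: ler_pM => //; first exact: ltW.
    by apply: le_trans sy _; rewrite ler_wpM2l// ltW.
  by apply: ler_pM => //; apply: le_trans E1 _; lra.
have mn : m * n <= e / 8 * n by rewrite ler_wpM2r.
apply: le_trans (lerD r i) _.
have : e / 8 * n + 2 * (e / 8 * n) + (2 * (e / 8 * n) + e / 4 * n) <= e * n.
  have -> : e / 8 * n + 2 * (e / 8 * n) + (2 * (e / 8 * n) + e / 4 * n) = 7 / 8 * (e * n).
    by field.
  have en : 0 <= e * n by apply: mulr_ge0 => //; exact: ltW.
  lra.
lra.
Qed.

Lemma cdif_cexp z : cdif cexp z.
Proof.
have -> : cexp = fun w => cexp z * cexp (w - z).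
  by apply: funext => w; rewrite -cexpD addrC subrK.
apply: cdifM; first exact: cdif_cst.
apply: cdif_comp; first by rewrite subrr; exact: cdif_cexp0.
by apply: cdifB; [exact: cdif_id|exact: cdif_cst].
Qed.

Lemma cexp_period (x : R) : cexp (x +i* (2 * pi)) = cexp (x +i* 0).
Proof. by rewrite /cexp/= expi_2pi expi0. Qed.

Lemma pcont_expi t : pcont expi t.
Proof. by split; [exact: continuous_cos|exact: continuous_sin]. Qed.

End cexp.

(** * Means over circles *)

Section circle_means.
Context {R : realType}.
Implicit Types (f g : R[i] -> R[i]) (s r : R) (z w : R[i]).

Definition circle_mean f s : R[i] :=
  ((2 * pi)^-1)%:C * cint (fun t => f (s%:C * expi t)) 0 (2 * pi).

Definition ccirc f s := forall z, nc z = s -> ccont f z.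

Lemma pi2_gt0 : 0 < 2 * pi :> R. Proof. by rewrite mulr_gt0// pi_gt0. Qed.

Lemma nc_circle s t : 0 <= s -> nc (s%:C * expi t) = s.
Proof. by move=> s0; rewrite ncM nc_expi nc_real ger0_norm// mulr1. Qed.

Lemma pcont_on_circle f s : 0 <= s -> ccirc f s ->
  pcont_on (fun t => f (s%:C * expi t)) 0 (2 * pi).
Proof.
move=> s0 cf t _; apply: (@cvgc_comp _ _ _ _ (fun t => s%:C * expi t)).
  by apply: cf; rewrite nc_circle.
by apply: cvgcM; [exact: cvgc_cst|exact: pcont_expi].
Qed.

Lemma eq_mean f g s : 0 <= s -> (forall z, nc z = s -> f z = g z) ->
  circle_mean f s = circle_mean g s.
Proof.
move=> s0 fg; congr (_ * _); apply: eq_cint => t _.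
by rewrite fg// nc_circle.
Qed.

Lemma meanD f g s : 0 <= s -> ccirc f s -> ccirc g s ->
  circle_mean (fun z => f z + g z) s = circle_mean f s + circle_mean g s.
Proof.
by move=> s0 cf cg; rewrite /circle_mean -mulrDr -cintD//; exact: pcont_on_circle.
Qed.

Lemma meanB f g s : 0 <= s -> ccirc f s -> ccirc g s ->
  circle_mean (fun z => f z - g z) s = circle_mean f s - circle_mean g s.
Proof.
by move=> s0 cf cg; rewrite /circle_mean -mulrBr -cintB//; exact: pcont_on_circle.
Qed.

Lemma meanZ (k : R[i]) f s : 0 <= s -> ccirc f s ->
  circle_mean (fun z => k * f z) s = k * circle_mean f s.
Proof.
by move=> s0 cf; rewrite /circle_mean [RHS]mulrCA -(cintZ k (pcont_on_circle s0 cf)).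
Qed.

Lemma mean_cst (k : R[i]) s : circle_mean (fun=> k) s = k.
Proof.
rewrite /circle_mean cint_cst ?ltW ?pi2_gt0// subr0 mulrCA -rmorphM/= mulVf ?mulr1//.
by rewrite gt_eqF// pi2_gt0.
Qed.

Lemma mean_conj f s : 0 <= s -> ccirc f s ->
  circle_mean (fun z => conjc (f z)) s = conjc (circle_mean f s).
Proof.
move=> s0 cf; rewrite /circle_mean conj_mulc -cint_conj; last exact: pcont_on_circle.
by congr (_ * _); apply: Complex_eq => //=; rewrite oppr0.
Qed.

Lemma mean0 f : circle_mean f 0 = f 0.
Proof.
rewrite -[RHS](mean_cst (f 0) 0); congr (_ * _); apply: eq_cint => t _.
by rewrite mul0r.
Qed.

Lemma mean_le_Re f g s : 0 <= s -> ccirc f s -> ccirc g s ->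
  (forall z, nc z = s -> nc (f z) <= Re (g z)) -> nc (circle_mean f s) <= 2 * Re (circle_mean g s).
Proof.
move=> s0 cf cg fg.
have cpf := pcont_on_circle s0 cf; have cpg := pcont_on_circle s0 cg.
rewrite /circle_mean ncM nc_real ReM /= mul0r subr0 ger0_norm; last first.
  by rewrite invr_ge0 ltW// pi2_gt0.
rewrite mulrCA ler_pM2l ?invr_gt0 ?pi2_gt0//.
apply: cint_le => //; first exact: pcont_on_Re.
by move=> t _; apply: fg; rewrite nc_circle.
Qed.

Lemma mean_le f M s : 0 <= s -> ccirc f s ->
  (forall z, nc z = s -> nc (f z) <= M) -> nc (circle_mean f s) <= 2 * M.
Proof.
move=> s0 cf fM; rewrite -[M]/(Re M%:C) -(mean_cst M%:C s).
by apply: mean_le_Re => // z _; exact: ccont_cst.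
Qed.

(** The exponential maps the rectangle between [ln s1] and [ln s2], of height [2
* pi], onto the annulus. Around this rectangle the integral of [f] composed
with [cexp] is 0, the horizontal sides cancel by periodicity, and the
vertical sides are the two means. *)
Lemma mean_annulus f s1 s2 : 0 < s1 <= s2 ->
  (forall z, s1 <= nc z <= s2 -> cdif f z) -> circle_mean f s1 = circle_mean f s2.
Proof.
move=> /andP[s10 s12] df; have s20 := lt_le_trans s10 s12.
congr (_ * _).
have l12 : ln s1 <= ln s2 by rewrite ler_ln ?posrE.
have pi0 : 0 <= 2 * pi :> R by rewrite ltW// pi2_gt0.
have dfe w : in_rect (ln s1) (ln s2) 0 (2 * pi) w -> cdif (fun w => f (cexp w)) w.
  move=> /andP[/andP[w1 w2] _]; apply: cdif_comp; last exact: cdif_cexp.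
  by apply: df; rewrite nc_cexp -(lnK s10) -(lnK s20) !ler_expR w1.
have := goursat l12 pi0 dfe.
rewrite /rect_loop (_ : cint _ (ln s1) (ln s2) = cint (fun x => f (cexp (x +i* (2 * pi)))) (ln s1) (ln s2)).
  rewrite subrr add0r => /eqP; rewrite mulf_eq0 => /orP[|].
    by rewrite -nc_eq0 /nc/= expr0n add0r expr1n sqrtr1 oner_eq0.
  rewrite subr_eq0 => /eqP/esym.
  by rewrite /cexp/=; do 2 rewrite lnK//.
by apply: eq_cint => x _; rewrite cexp_period.
Qed.

(** Uniform continuity of [f] near the circle, from the compactness of the
interval of angles. *)
Lemma mean_cont f r s0 : (forall z, nc z < r -> ccont f z) -> 0 <= s0 < r ->
  forall e : R, 0 < e -> exists2 d, 0 < d & forall s, 0 <= s < r ->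
    `|s - s0| < d -> nc (circle_mean f s - circle_mean f s0) <= e.
Proof.
move=> cf /andP[s00 s0r] e e0.
have e40 : 0 < e / 4 by rewrite divr_gt0.
pose P s t := nc (f (s%:C * expi t) - f (s0%:C * expi t)) < e / 2.
have : \forall s \near s0, `[0, 2 * pi]%classic `<=` P s.
  have /compact_near_coveringP cov := @segment_compact R 0 (2 * pi).
  apply: (cov R (nbhs s0) P) => t _.
  have ct : ccont f (s0%:C * expi t) by apply: cf; rewrite nc_circle.
  pose F := filter_prod (nbhs t) (nbhs s0).
  have c1 : cvgc F (fun p => expi p.1) (expi t).
    have [cr ci] := pcont_expi t.
    by split; [apply: cvg_comp cr|apply: cvg_comp ci]; exact: cvg_fst.
  have c2 : cvgc F (fun p => p.2%:C) s0%:C by apply: cvgc_real; exact: cvg_snd.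
  have H1 : \forall p \near F, nc (f (p.2%:C * expi p.1) - f (s0%:C * expi t)) < e / 4.
    by apply/(cvgc_lt _ _).1: e40; apply: cvgc_comp ct _; exact: cvgcM.
  have H2 : \forall p \near F, nc (f (s0%:C * expi p.1) - f (s0%:C * expi t)) < e / 4.
    apply/(cvgc_lt _ _).1: e40; apply: (@cvgc_comp _ _ F _ (fun p => s0%:C * expi p.1)) ct _.
    by apply: cvgcM => //; exact: cvgc_cst.
  apply: filterS2 H1 H2 => -[t' s'] /= h1 h2; rewrite /P.
  apply: le_lt_trans (nc_triangle (f (s0%:C * expi t)) _ _) _.
  by rewrite [X in _ + X]ncBC (_ : e / 2 = e / 4 + e / 4) ?ltrD//; lra.
move=> [d /= d0 dP]; exists d => // s /andP[ss sr] sd.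
have cs s' : 0 <= s' < r -> ccirc f s'.
  by move=> /andP[? ?] z zs; apply: cf; rewrite zs.
have ps := pcont_on_circle ss (cs s _); have ps0 := pcont_on_circle s00 (cs s0 _).
rewrite /circle_mean -mulrBr -cintB; [|apply: ps; rewrite ss sr|apply: ps0; rewrite s00 s0r]; rewrite //.
rewrite ncM nc_real ger0_norm; last by rewrite invr_ge0 ltW// pi2_gt0.
rewrite mulrC ler_pdivrMr ?pi2_gt0//.
apply: le_trans (cint_le_cst (M := e / 2) _ _ _) _.
- by rewrite ltW// pi2_gt0.
- by apply: pcont_onB; [apply: ps; rewrite ss sr|apply: ps0; rewrite s00 s0r].
- move=> t t01; apply/ltW; apply: (dP s); first by rewrite /= distrC.
  by rewrite /= in_itv.
- by rewrite subr0 (_ : 2 * (e / 2) = e)//; field.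
Qed.

End circle_means.

(** * Cauchy's formula *)

Section cauchy.
Context {R : realType}.
Implicit Types (f g : R[i] -> R[i]) (s r c : R) (z w : R[i]).

(** A mean that is also attained at radii arbitrarily close to [c] is the mean
at [c]. *)
Lemma mean_limit f r c s : (forall z, nc z < r -> ccont f z) ->
  0 <= c < r -> 0 <= s < r ->
  (forall d : R, 0 < d -> exists s', [/\ 0 <= s' < r, `|s' - c| < d & circle_mean f s' = circle_mean f s]) ->
  circle_mean f s = circle_mean f c.
Proof.
move=> cf cr sr near_c; apply/eqP; rewrite -subr_eq0 -nc_eq0 eq_le nc_ge0 andbT.
apply/ler_addgt0Pr => e e0; rewrite add0r.
have [d d0 dP] := mean_cont cf cr e0.
by have [s' [s'r s'c <-]] := near_c d d0; exact: dP.
Qed.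

(** One exceptional point [z0], where [f] is only continuous, is allowed: the
mean is constant for radii below [nc z0] and for radii above, and it is
continuous in the radius. This is what makes the lemma applicable to a
difference quotient at [z0]. *)
Lemma mean_value f r z0 s : (forall z, nc z < r -> ccont f z) ->
  (forall z, nc z < r -> z != z0 -> cdif f z) -> 0 < s < r -> circle_mean f s = f 0.
Proof.
move=> cf df; set c := nc z0.
(* Below [c] the mean is constant; letting the radius tend to 0 gives [f 0]. *)
have inner t : 0 < t < r -> t < c -> circle_mean f t = f 0.
  move=> /andP[t0 tr] tc; rewrite -mean0; apply: (mean_limit cf).
  - by rewrite lexx (lt_trans t0).
  - by rewrite tr ltW.
  - move=> d d0; exists (Num.min (d / 2) t).
    have m0 : 0 < Num.min (d / 2) t by rewrite lt_min t0 divr_gt0.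
    split; first by rewrite ltW//= gt_min tr orbT.
      by rewrite subr0 gtr0_norm// gt_min; apply/orP; left; lra.
    apply: mean_annulus; first by rewrite m0 ge_min lexx orbT.
    move=> z /andP[_ zt]; apply: df; first exact: le_lt_trans tr.
    by apply/eqP => z0z; move: tc; rewrite ltNge /c -z0z zt.
(* At [c], by letting the radius increase to [c]. *)
have on_c : c < r -> circle_mean f c = f 0.
  move=> cr; have [c0|c0] := leP c 0.
    by rewrite -mean0; congr circle_mean; apply/eqP; rewrite eq_le c0 nc_ge0.
  have c2 : c / 2 < c by lra.
  rewrite -(inner (c / 2)); [|lra|lra].
  apply/esym/(mean_limit cf); [lra|lra|].
  move=> d d0; exists (Num.max (c - d / 2) (c / 2)).
  have mc : Num.max (c - d / 2) (c / 2) < c by rewrite gt_max; apply/andP; split; lra.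
  have m2 : c / 2 <= Num.max (c - d / 2) (c / 2) by rewrite le_max lexx orbT.
  have md : c - d / 2 <= Num.max (c - d / 2) (c / 2) by rewrite le_max lexx.
  split; first lra.
    by rewrite ltr_norml; apply/andP; split; lra.
  apply/esym/mean_annulus; first lra.
  move=> z /andP[_ zt]; apply: df; first lra.
  by apply/eqP => z0z; move: zt; rewrite z0z leNgt mc.
move=> /andP[s0 sr]; have [sc|cs|sE] := ltgtP s c.
- by apply: inner => //; rewrite s0.
- have c0 : 0 <= c := nc_ge0 _.
  rewrite -on_c; last lra.
  apply: (mean_limit cf); [lra|lra|] => d d0; exists (Num.min (c + d / 2) s).
  have ms : Num.min (c + d / 2) s <= s by rewrite ge_min lexx orbT.
  have md : Num.min (c + d / 2) s <= c + d / 2 by rewrite ge_min lexx.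
  have mc : c < Num.min (c + d / 2) s by rewrite lt_min; apply/andP; split; lra.
  split; first lra.
    by rewrite ltr_norml; apply/andP; split; lra.
  apply: mean_annulus; first lra.
  move=> z /andP[zt zs]; apply: df; first lra.
  by apply/eqP => z0z; move: zt; rewrite z0z leNgt mc.
- by rewrite sE; apply: on_c; rewrite -sE.
Qed.

Lemma ccont_kernel s z w : nc z < s -> nc w = s -> ccont (fun w => (w - z)^-1) w.
Proof.
move=> zs ws; apply: cdif_ccont; apply: cdifV.
  by rewrite subr_eq0; apply/eqP => wz; move: zs; rewrite -wz ws ltxx.
by apply: cdifB; [exact: cdif_id|exact: cdif_cst].
Qed.

(** On the circle of radius [s] the conjugate of [w] is [s ^+ 2 / w], which
turns the conjugate of the kernel into a holomorphic function of [w]. *)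
Lemma reflected_kernel s z w : 0 < s -> nc w = s -> nc z < s ->
  conjc (z / (w - z)) = conjc z * w / ((s ^+ 2)%:C - conjc z * w).
Proof.
move=> s0 ws zs.
have w0 : w != 0 by rewrite -nc_gt0 ws.
have wz : w - z != 0.
  by rewrite subr_eq0; apply/eqP => wz; move: zs; rewrite -wz ws ltxx.
have cj0 (u : R[i]) : u != 0 -> conjc u != 0.
  by rewrite -!nc_gt0 nc_conj.
rewrite conj_mulc conj_invc -ws -mul_conjc.
have -> : w * conjc w - conjc z * w = w * conjc (w - z).
  by rewrite (mulrC _ w) conj_addc conj_oppc; ring.
by rewrite invfM !mulrA mulfK.
Qed.

Lemma cdif_reflected s z w : nc z * nc w < s ^+ 2 ->
  cdif (fun w => conjc z * w / ((s ^+ 2)%:C - conjc z * w)) w.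
Proof.
move=> zw; have dl : cdif (fun w => conjc z * w) w.
  by apply: cdifM; [exact: cdif_cst|exact: cdif_id].
apply: cdifM => //; apply: cdifV; last by apply: cdifB => //; exact: cdif_cst.
rewrite subr_eq0; apply/eqP => E; move: zw.
by rewrite -(nc_conj z) -ncM -E nc_real ger0_norm ?sqr_ge0// ltxx.
Qed.

(** On the circle the conjugate kernel is a holomorphic function that vanishes
at 0, so the mean value property gives 0. *)
Lemma mean_reflected f r s z : (forall w, nc w < r -> cdif f w) ->
  nc z < s -> s < r -> circle_mean (fun w => f w * conjc (z / (w - z))) s = 0.
Proof.
move=> df zs sr; have s0 : 0 < s := le_lt_trans (nc_ge0 _) zs.
pose k w := conjc z * w / ((s ^+ 2)%:C - conjc z * w).
rewrite (@eq_mean _ _ (fun w => f w * k w)) ?ltW//; last first.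
  by move=> w ws; rewrite (reflected_kernel s0 ws zs).
(* The reflected kernel is differentiable for [nc w < s ^+ 2 / nc z], and this
   radius exceeds [s]. *)
have [r' [sr' rr' zr']] : exists r', [/\ s < r', r' <= r & nc z * r' <= s ^+ 2].
  have [z0|z0] := leP (nc z) 0.
    exists r; split => //; apply: le_trans (sqr_ge0 _).
    by rewrite mulr_le0_ge0// ltW// (lt_trans s0).
  exists (Num.min r (s ^+ 2 / nc z)); split.
  - by rewrite lt_min sr ltr_pdivlMr// expr2 ltr_pM2l.
  - by rewrite ge_min lexx.
  - by rewrite mulrC -ler_pdivlMr// ge_min lexx orbT.
have dfk w : nc w < r' -> cdif (fun w => f w * k w) w.
  move=> wr; apply: cdifM; first by apply: df; exact: lt_le_trans rr'.
  apply: cdif_reflected; have [z0|z0] := leP (nc z) 0.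
    have -> : nc z = 0 by apply/eqP; rewrite eq_le z0 nc_ge0.
    by rewrite mul0r exprn_gt0.
  by apply: lt_le_trans zr'; rewrite ltr_pM2l.
rewrite (@mean_value _ r' 0) ?s0//; last 2 first.
- by move=> w /dfk; exact: cdif_ccont.
- by move=> w /dfk.
by rewrite /k mulr0 mul0r mulr0.
Qed.

Lemma mean_kernel s z : nc z < s -> circle_mean (fun w => z / (w - z)) s = 0.
Proof.
move=> zs; have s0 : 0 <= s := le_trans (nc_ge0 _) (ltW zs).
have ck : ccirc (fun w => z / (w - z)) s.
  by move=> w ws; apply: cvgcM; [exact: cvgc_cst|exact: ccont_kernel ws].
apply/eqP; rewrite -nc_eq0 -nc_conj -mean_conj//.
rewrite -(@eq_mean _ (fun w => 1 * conjc (z / (w - z)))) ?(@mean_reflected _ (s + 1)) ?nc0 ?ltrDl//.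
  by move=> w _; exact: cdif_cst.
by move=> w _; rewrite mul1r.
Qed.

(** The mean value property, applied to [p w * w] with [p] the difference
quotient of [f] at [z]. *)
Lemma cauchy_formula f r s z : (forall w, nc w < r -> cdif f w) ->
  nc z < s -> s < r -> f z = circle_mean (fun w => f w * (w / (w - z))) s.
Proof.
move=> df zs sr; have s0 : 0 < s := le_lt_trans (nc_ge0 _) zs.
have zr : nc z < r by lra.
have [p cp fE] := df z zr.
have pE w : w != z -> p w = (f w - f z) / (w - z).
  by move=> wz; rewrite fE addrAC subrr add0r mulfK// subr_eq0.
have dp w : nc w < r -> w != z -> cdif p w.
  move=> wr wz; apply: (@near_cdif _ (fun w => (f w - f z) / (w - z))).
    have := ccont_near_neq0 (f := fun w => w - z).
    case/(_ w) => [||d d0 dP]; last by exists d => // u /dP; rewrite subr_eq0 => /pE.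
    - by apply: cvgcB; [exact: ccont_id|exact: cvgc_cst].
    - by rewrite subr_eq0.
  apply: cdifM; first by apply: cdifB; [exact: df|exact: cdif_cst].
  apply: cdifV; first by rewrite subr_eq0.
  by apply: cdifB; [exact: cdif_id|exact: cdif_cst].
have cpr w : nc w < r -> ccont p w.
  by have [->|wz wr] := eqVneq w z; [|exact/cdif_ccont/dp].
have : circle_mean (fun w => p w * w) s = 0.
  rewrite (@mean_value _ r z) ?mulr0 ?s0//.
  - by move=> w wr; apply: cvgcM; [exact: cpr|exact: ccont_id].
  - by move=> w wr wz; apply: cdifM; [exact: dp|exact: cdif_id].
have ck : ccirc (fun w => w / (w - z)) s.
  by move=> w ws; apply: cvgcM; [exact: ccont_id|exact: ccont_kernel ws].
rewrite (@eq_mean _ _ (fun w => f w * (w / (w - z)) - f z * (w / (w - z)))) ?ltW//; last first.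
  move=> w ws; rewrite pE ?mulrBl//; first by ring.
  by apply/eqP => wz; move: zs; rewrite -wz ws ltxx.
rewrite meanB ?meanZ ?ltW//; last 2 first.
- move=> w ws; apply: cvgcM; last exact: ck.
  by apply/cdif_ccont/df; rewrite ws.
- by move=> w ws; apply: cvgcM; [exact: cvgc_cst|exact: ck].
move/eqP; rewrite subr_eq0 => /eqP ->.
rewrite (@eq_mean _ _ (fun w => 1 + z / (w - z))) ?ltW//; last first.
  move=> w ws; have wz : w - z != 0.
    by rewrite subr_eq0; apply/eqP => wz; move: zs; rewrite -wz ws ltxx.
  by field.
rewrite meanD ?mean_cst ?mean_kernel ?addr0 ?mulr1 ?ltW//.
- by move=> w _; exact: ccont_cst.
- by move=> w ws; apply: cvgcM; [exact: cvgc_cst|exact: ccont_kernel ws].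
Qed.

End cauchy.

(** * Cauchy estimates and division by a zero *)

Section cauchy_estimates.
Context {R : realType}.
Implicit Types (f g : R[i] -> R[i]) (s r c : R) (z w : R[i]).

(** Used to turn a bound over all angles into a bound over the whole circle. *)
Lemma polar z : exists2 t : R, - pi <= t <= pi & z = (nc z)%:C * expi t.
Proof.
have [->|z0] := eqVneq z 0.
  by exists 0; rewrite ?nc0 ?mul0r// oppr_le0 pi_ge0.
have nz : 0 < nc z by rewrite nc_gt0.
pose x := Re z / nc z; pose y := Im z / nc z.
have xy : x ^+ 2 + y ^+ 2 = 1.
  rewrite !exprMn -mulrDl -sqr_nc exprVn mulfV//.
  by rewrite sqrf_eq0 gt_eqF.
have x1 : -1 <= x <= 1.
  rewrite -ler_norml normrM normfV (ger0_norm (nc_ge0 z)) ler_pdivrMr// mul1r.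
  exact: norm_Re_le.
have zE : z = (nc z)%:C * (x +i* y).
  by apply: Complex_eq; rewrite ?ReM ?ImM/= mul0r ?subr0 ?addr0 /x /y; field; rewrite gt_eqF.
have sx : sin (acos x) = `|y|.
  rewrite sin_acos// (_ : 1 - x ^+ 2 = y ^+ 2) ?sqrtr_sqr//; lra.
have [y0|y0] := leP 0 y.
  exists (acos x); first by rewrite acos_lepi// (le_trans _ (acos_ge0 x1))// oppr_le0 pi_ge0.
  by rewrite {1}zE /expi acosK// sx ger0_norm.
exists (- acos x).
  by rewrite lerN2 acos_lepi//= lerNl (le_trans _ (acos_ge0 x1))// oppr_le0 pi_ge0.
by rewrite {1}zE /expi cosN sinN acosK// sx ltr0_norm// opprK.
Qed.

Lemma circle_bounded f s : 0 <= s -> ccirc f s ->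
  exists M, forall z, nc z = s -> nc (f z) <= M.
Proof.
move=> s0 cf.
have pipi : - pi <= pi :> R by rewrite ge0_cp// pi_ge0.
have [t|t _ tM] := @EVT_max R (fun t => nc (f (s%:C * expi t))) _ _ pipi.
  apply: continuous_in_subspaceT => x _; apply: cvgc_norm.
  apply: (@cvgc_comp _ _ _ _ (fun t => s%:C * expi t)).
    by apply: cf; rewrite nc_circle.
  by apply: cvgcM; [exact: cvgc_cst|exact: pcont_expi].
exists (nc (f (s%:C * expi t))) => z zs.
by have [u ut ->] := polar z; rewrite zs; apply: tM; rewrite in_itv.
Qed.

Lemma circle_sub_neq0 s z w : nc z < s -> nc w = s -> w - z != 0.
Proof.
by move=> zs ws; rewrite subr_eq0; apply/eqP => wz; move: zs; rewrite -wz ws ltxx.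
Qed.

Lemma kernel_le s z w : nc z < s -> nc w = s -> nc (w - z)^-1 <= (s - nc z)^-1.
Proof.
move=> zs ws; rewrite ncV lef_pV2 ?posrE ?subr_gt0//.
  by rewrite -ws le_nc_subl.
by rewrite nc_gt0 (circle_sub_neq0 zs).
Qed.

Lemma cauchy_bound f M r s z : (forall w, nc w < r -> cdif f w) ->
  nc z < s -> s < r -> (forall w, nc w = s -> nc (f w) <= M) ->
  nc (f z) <= 2 * (M * (s / (s - nc z))).
Proof.
move=> df zs sr fM; have s0 : 0 < s := le_lt_trans (nc_ge0 _) zs.
rewrite (cauchy_formula df zs sr); apply: mean_le; first exact: ltW.
  move=> w ws; apply: cvgcM; first by apply/cdif_ccont/df; rewrite ws.
  by apply: cvgcM; [exact: ccont_id|exact: ccont_kernel ws].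
have s0' := ltW s0.
move=> w ws; rewrite !ncM ws; apply: ler_pM; rewrite ?mulr_ge0 ?nc_ge0//.
  exact: fM.
by rewrite ler_pM2l// kernel_le.
Qed.

(** Compare the Cauchy integrals of [f] at the two points over a circle slightly
larger than that of radius [s]. *)
Lemma cauchy_lipschitz f r s : (forall w, nc w < r -> cdif f w) -> 0 < s < r ->
  exists2 L : R, 0 < L & forall z w, nc z <= s -> nc w <= s ->
    nc (f z - f w) <= L * nc (z - w).
Proof.
move=> df /andP[s0 sr].
have [t st tr] : exists2 t, s < t & t < r by exists ((s + r) / 2); lra.
have t0 : 0 < t := lt_trans s0 st.
have ct : ccirc f t by move=> w wt; apply/cdif_ccont/df; rewrite wt.
have [M fM] := circle_bounded (ltW t0) ct.
have M0 : 0 <= M by apply: le_trans (fM t%:C _); rewrite ?nc_ge0// nc_real gtr0_norm.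
pose q := (t - s)^-1; have q0 : 0 < q by rewrite invr_gt0 subr_gt0.
have [t0' q0'] : 0 <= t /\ 0 <= q by rewrite !ltW.
exists (2 * (M * (t * (q * q))) + 1).
  by apply: ltr_wpDl => //; do !apply: mulr_ge0.
move=> z w zs ws; have zt := le_lt_trans zs st; have wt := le_lt_trans ws st.
rewrite (cauchy_formula df zt tr) (cauchy_formula df wt tr).
have cz u : nc u < t -> ccirc (fun w => f w * (w / (w - u))) t.
  move=> ut v vt; apply: cvgcM; first exact: ct.
  by apply: cvgcM; [exact: ccont_id|exact: ccont_kernel vt].
rewrite -meanB//; [|exact: cz..].
apply: (@le_trans _ _ (2 * (M * (t * (q * q)) * nc (z - w)))); last first.
  by rewrite mulrA ler_wpM2r ?nc_ge0// lerDl.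
apply: mean_le => [| |v vt]; first exact: ltW.
  by move=> v vt; apply: cvgcB; exact: cz.
have kq u : nc u <= s -> nc (v - u)^-1 <= q.
  move=> us; apply: le_trans (kernel_le (le_lt_trans us st) vt) _.
  by rewrite lef_pV2 ?posrE ?subr_gt0 ?lerB// (le_lt_trans us).
rewrite (_ : _ - _ = f v * (v * ((v - z)^-1 * (v - w)^-1)) * (z - w)); last first.
  by field; rewrite !(circle_sub_neq0 _ vt).
rewrite ncM ler_wpM2r ?nc_ge0// !ncM vt.
apply: ler_pM; rewrite ?mulr_ge0 ?nc_ge0//; first exact: fM.
by rewrite ler_pM2l//; apply: ler_pM; rewrite ?nc_ge0 ?kq.
Qed.

(** The derivative is obtained by differentiating the kernel; the remainder of
the kernel is quadratic in [u - z], uniformly on the circle. *)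
Lemma cdif_cauchy_integral f s z : ccirc f s -> nc z < s ->
  cdif (fun z => circle_mean (fun w => f w / (w - z)) s) z.
Proof.
move=> cf zs; have s0 : 0 < s := le_lt_trans (nc_ge0 _) zs.
have [M fM] := circle_bounded (ltW s0) cf.
have M0 : 0 <= M by apply: le_trans (fM s%:C _); rewrite ?nc_ge0// nc_real gtr0_norm.
apply/cdifP; exists (circle_mean (fun w => f w / (w - z) / (w - z)) s) => e e0.
pose d := (s - nc z) / 2; have d0 : 0 < d by rewrite divr_gt0// subr_gt0.
pose K := 2 * (M * (d^-1 * (d^-1 * d^-1))) + 1.
have d0' : 0 <= d^-1 by rewrite invr_ge0 ltW.
have K0 : 0 < K by apply: ltr_wpDl => //; do !apply: mulr_ge0.
exists (Num.min d (e / K)); first by rewrite lt_min d0 divr_gt0.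
move=> u; rewrite lt_min => /andP[ud ue].
have zd : nc z + d < s by rewrite /d; lra.
have us : nc u < s.
  by apply: le_lt_trans zd; have := nc_triangle z u 0; rewrite !subr0; lra.
have c1 v : nc v < s -> ccirc (fun w => f w / (w - v)) s.
  by move=> vs w ws; apply: cvgcM; [exact: cf|exact: ccont_kernel ws].
have c2 : ccirc (fun w => f w / (w - z) / (w - z)) s.
  by move=> w ws; apply: cvgcM; [exact: c1|exact: ccont_kernel ws].
have c3 : ccirc (fun w => (u - z) * (f w / (w - z) / (w - z))) s.
  by move=> w ws; apply: cvgcM; [exact: cvgc_cst|exact: c2].
have s0' := ltW s0.
rewrite (mulrC _ (u - z)) -meanZ// -meanD//; last exact: c1.
rewrite -meanB//; [|exact: c1|by move=> w ws; apply: cvgcD; [exact: c1|exact: c3]].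
apply: (@le_trans _ _ (K * nc (u - z) * nc (u - z))); last first.
  by rewrite ler_wpM2r ?nc_ge0// mulrC -ler_pdivlMr// ltW.
apply: (@le_trans _ _ (2 * (M * (d^-1 * (d^-1 * d^-1)) * (nc (u - z) * nc (u - z))))); last first.
  by rewrite mulrA -[leRHS]mulrA ler_wpM2r ?mulr_ge0 ?nc_ge0// lerDl.
apply: mean_le => [| |w ws]; first exact: ltW.
  move=> w ws; apply: cvgcB; first exact: c1.
  by apply: cvgcD; [exact: c1|exact: c3].
have kd v : nc v <= nc z + d -> nc (w - v)^-1 <= d^-1.
  move=> vd; have vs := le_lt_trans vd zd.
  apply: le_trans (kernel_le vs ws) _.
  by rewrite lef_pV2 ?posrE ?subr_gt0//; rewrite /d in vd *; lra.
rewrite (_ : _ - _ = f w * ((w - u)^-1 * ((w - z)^-1 * (w - z)^-1)) * ((u - z) * (u - z))).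
  rewrite ncM (ncM (u - z)) ler_wpM2r ?mulr_ge0 ?nc_ge0// !ncM.
  have ku := kd u _; have kz := kd z _.
  apply: ler_pM; rewrite ?mulr_ge0 ?nc_ge0//; first exact: fM.
  apply: ler_pM; rewrite ?mulr_ge0 ?nc_ge0//.
    by apply: ku; have := nc_triangle z u 0; rewrite !subr0; lra.
  by apply: ler_pM; rewrite ?nc_ge0// kz// lerDl ltW.
by field; rewrite !(circle_sub_neq0 _ ws).
Qed.

End cauchy_estimates.

Section division.
Context {R : realType}.
Implicit Types (g : R[i] -> R[i]) (z w c : R[i]).

(** Away from [c] the quotient is differentiable by the usual rules; near [c] it
is a Cauchy integral, because the difference of the Cauchy formulas at [z]
and at [c] has [z - c] as a factor. *)
Lemma divide_zero g c : c != 0 -> (forall z, cdif g z) -> g c = 0 ->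
  exists2 G, (forall z, cdif G z) & forall z, g z = (1 - z / c) * G z.
Proof.
move=> c0 dg gc; pose s := nc c + 1.
have cs : nc c < s by rewrite ltrDl.
(* [H] is [g z / (z - c)], written in a form that is differentiable at [c]. *)
pose H z := circle_mean (fun w => g w * w / (w - c) / (w - z)) s.
have ck : ccirc (fun w => g w * w / (w - c)) s.
  move=> w ws; apply: cvgcM; last exact: ccont_kernel ws.
  by apply: cvgcM; [exact/cdif_ccont/dg|exact: ccont_id].
have dH z : nc z < s -> cdif H z by exact: cdif_cauchy_integral.
have gH z : nc z < s -> g z = (z - c) * H z.
  move=> zs; have s0 : 0 < s := le_lt_trans (nc_ge0 _) zs.
  rewrite -[g z]subr0 -gc.
  have ss : s < s + 1 by rewrite ltrDl.
  rewrite (@cauchy_formula _ g (s + 1) s z)// (@cauchy_formula _ g (s + 1) s c)//.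
  have cg u : nc u < s -> ccirc (fun w => g w * (w / (w - u))) s.
    move=> us w ws; apply: cvgcM; first exact/cdif_ccont/dg.
    by apply: cvgcM; [exact: ccont_id|exact: ccont_kernel ws].
  have s0' := ltW s0.
  rewrite -meanB//; [|exact: cg..].
  rewrite -meanZ//; last first.
    by move=> w ws; apply: cvgcM; [exact: ck|exact: ccont_kernel ws].
  apply: eq_mean; first exact: ltW.
  by move=> w ws; field; rewrite !(circle_sub_neq0 _ ws).
pose G z := - c * (if z == c then H c else g z / (z - c)).
exists G => z; last first.
  rewrite /G; have [->|zc] := eqVneq z c; first by rewrite gc divff// subrr mul0r.
  rewrite mulrA (_ : (1 - z / c) * - c = z - c); last by field.
  by rewrite mulrC divfK// subr_eq0.
have [zs|zs] := ltP (nc z) s.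
  apply: (@near_cdif _ (fun z => - c * H z)).
    exists (s - nc z); first by rewrite subr_gt0.
    move=> w wz; have ws : nc w < s.
      by have := nc_triangle z w 0; rewrite !subr0; lra.
    rewrite /G; have [->//|wc] := eqVneq w c.
    by rewrite gH// (mulrC (w - c)) mulfK// subr_eq0.
  by apply: cdifM; [exact: cdif_cst|exact: dH].
have zc : z - c != 0.
  by rewrite subr_eq0; apply/eqP => zc; move: cs; rewrite -zc ltNge zs.
apply: (@near_cdif _ (fun z => - c * (g z / (z - c)))).
  have := ccont_near_neq0 (f := fun w => w - c).
  case/(_ z) => // [|d d0 dP]; first by apply: cvgcB; [exact: ccont_id|exact: cvgc_cst].
  by exists d => // w /dP; rewrite subr_eq0 /G => /negbTE ->.
apply: cdifM; first exact: cdif_cst.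
apply: cdifM; first exact: dg.
by apply: cdifV => //; apply: cdifB; [exact: cdif_id|exact: cdif_cst].
Qed.

End division.

(** * The Borel-Caratheodory inequality and functions without zeros *)

Section borel_caratheodory.
Context {R : realType}.
Implicit Types (f F : R[i] -> R[i]) (s r B : R) (z w : R[i]).

(** Adding to the Cauchy formula the vanishing mean of the conjugate of [F]
against the kernel, and subtracting the vanishing mean of [2 * B] against
it, expresses [F z - F 0] through the nonnegative function [B - Re (F w)],
whose mean is [B - Re (F 0)]. *)
Lemma borel_caratheodory F B r s z : (forall w, nc w < r -> cdif F w) ->
  nc z < s -> s < r -> (forall w, nc w = s -> Re (F w) <= B) ->
  nc (F z - F 0) <= 4 * (B - Re (F 0)) * (nc z / (s - nc z)).
Proof.
move=> dF zs sr FB; have s0 : 0 < s := le_lt_trans (nc_ge0 _) zs.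
have s0' := ltW s0.
have cF : ccirc F s by move=> w ws; apply/cdif_ccont/dF; rewrite ws.
pose k w := z / (w - z).
have ck : ccirc k s.
  by move=> w ws; apply: cvgcM; [exact: cvgc_cst|exact: ccont_kernel ws].
have cFk : ccirc (fun w => F w * k w) s.
  by move=> w ws; apply: cvgcM; [exact: cF|exact: ck].
have F0 : circle_mean F s = F 0.
  rewrite (@mean_value _ _ r 0) ?s0//; last by move=> w /dF.
  by move=> w /dF; exact: cdif_ccont.
have Fz : F z - F 0 = circle_mean (fun w => F w * k w) s.
  rewrite (cauchy_formula dF zs sr) -F0 -meanB//; last first.
    move=> w ws; apply: cvgcM; first exact: cF.
    by apply: cvgcM; [exact: ccont_id|exact: ccont_kernel ws].
  by apply: eq_mean => // w ws; rewrite /k; field; rewrite (circle_sub_neq0 zs ws).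
have Fj : circle_mean (fun w => conjc (F w) * k w) s = 0.
  apply/eqP; rewrite -nc_eq0 -nc_conj -mean_conj//; last first.
    by move=> w ws; apply: cvgcM; [apply: cvgc_conj; exact: cF|exact: ck].
  rewrite (@eq_mean _ _ (fun w => F w * conjc (z / (w - z)))) ?(mean_reflected dF) ?nc0//.
  by move=> w _; rewrite [LHS]conj_mulc conjc_conjc.
have cc : ccirc (fun w => (2 * B)%:C * k w) s.
  by move=> w ws; apply: cvgcM; [exact: cvgc_cst|exact: ck].
have cJ : ccirc (fun w => conjc (F w) * k w) s.
  by move=> w ws; apply: cvgcM; [apply: cvgc_conj; exact: cF|exact: ck].
have -> : F z - F 0 = circle_mean (fun w => - (2 * (B - Re (F w)))%:C * k w) s.
  rewrite (@eq_mean _ _ (fun w => F w * k w + conjc (F w) * k w - (2 * B)%:C * k w))//.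
    rewrite meanB//; last by move=> w ws; apply: cvgcD; [exact: cFk|exact: cJ].
    by rewrite meanD// Fj addr0 -Fz meanZ// mean_kernel// mulr0 subr0.
  move=> w _; rewrite -mulrDl -mulrBl; congr (_ * _).
  by case: (F w) => a b; apply: Complex_eq => /=; ring.
pose q := nc z / (s - nc z).
have q0 : 0 <= q by rewrite divr_ge0 ?nc_ge0// subr_ge0 ltW.
have -> : 4 * (B - Re (F 0)) * q = 2 * Re (circle_mean (fun w => (2 * q)%:C * (B%:C - F w)) s).
  rewrite meanZ ?meanB ?mean_cst ?F0//.
  - by rewrite ReM ReB/= mul0r subr0; ring.
  - by move=> w _; exact: ccont_cst.
  - by move=> w ws; apply: cvgcB; [exact: cvgc_cst|exact: cF].
apply: mean_le_Re => //.
- move=> w ws; apply: cvgcM; last exact: ck.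
  apply/cvgcN/cvgc_real; apply: cvgM; first exact: cvg_cst.
  by apply: cvgB; [exact: cvg_cst|case: (cF w ws)].
- move=> w ws; apply: cvgcM; first exact: cvgc_cst.
  by apply: cvgcB; [exact: cvgc_cst|exact: cF].
- move=> w ws; rewrite ncM ncN nc_real ReM ReB/= mul0r subr0.
  have BF : 0 <= B - Re (F w) by rewrite subr_ge0 FB.
  rewrite ger0_norm ?mulr_ge0// mulrAC ler_wpM2r// ler_wpM2l//.
  by rewrite /k ncM ler_wpM2l ?nc_ge0// kernel_le.
Qed.

End borel_caratheodory.

Section roots.
Context {R : realType}.
Notation sqrtc := (@sqrtc R).
Implicit Types (f F : R[i] -> R[i]) (s r B : R) (z w : R[i]).

Lemma Re_sqrtc_ge0 z : 0 <= Re (sqrtc z).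
Proof. by case: z => a b; rewrite /= sqrtr_ge0. Qed.

Lemma Re_sqrtc_gt0 z : 0 < Re z -> 0 < Re (sqrtc z).
Proof.
move=> z0; have nz : 0 <= nc z := nc_ge0 z.
move: z0 nz; rewrite /nc; case: z => a b /= a0 n0.
by rewrite sqrtr_gt0 divr_gt0// ltr_wpDl.
Qed.

Lemma cdif_sqrtc z : 0 < Re z -> cdif sqrtc z.
Proof.
move=> z0; set q := sqrtc z; have q0 : 0 < Re q by exact: Re_sqrtc_gt0.
have Req w : Re q <= nc (sqrtc w + q).
  by apply: le_trans (Re_le_nc _); rewrite ReD lerDr Re_sqrtc_ge0.
have neq w : sqrtc w + q != 0 by rewrite -nc_gt0; exact: lt_le_trans (Req w).
have qE w : sqrtc w = q + (sqrtc w + q)^-1 * (w - z).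
  rewrite (_ : w - z = (sqrtc w - q) * (sqrtc w + q)); last first.
    by rewrite -subr_sqr !sqr_sqrtc.
  by rewrite mulrC mulfK// addrC subrK.
exists (fun w => (sqrtc w + q)^-1) => //.
apply: (cvgcV (neq z)); apply: cvgcD; last exact: cvgc_cst.
apply: (@cvgc_squeeze _ _ _ _ (fun w => nc (w - z) / Re q)).
  apply: nearW => w; rewrite [in sqrtc w]qE addrC addKr ncM ncV mulrC.
  by rewrite ler_wpM2l ?nc_ge0// lef_pV2 ?posrE// (lt_le_trans q0).
rewrite -(mul0r (Re q)^-1); apply: cvgM; last exact: cvg_cst.
by apply/cvgc_nc; exact: ccont_id.
Qed.

(** The principal [2 ^ j]-th root; it is differentiable on the right half-plane. *)
Definition sqrtc_iter j : R[i] -> R[i] := iter j sqrtc.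

Lemma sqrtc_iter1 j : sqrtc_iter j 1 = 1.
Proof. by elim: j => //= j ->; rewrite sqrtc1. Qed.

Lemma sqrtc_iter_exp j z : sqrtc_iter j z ^+ (2 ^ j) = z.
Proof.
elim: j z => [|j ih] z; first by rewrite expr1.
by rewrite expnS exprM /= sqr_sqrtc ih.
Qed.

Lemma Re_sqrtc_iter_gt0 j z : 0 < Re z -> 0 < Re (sqrtc_iter j z).
Proof. by move=> z0; elim: j => //= j; exact: Re_sqrtc_gt0. Qed.

Lemma cdif_sqrtc_iter j z : 0 < Re z -> cdif (sqrtc_iter j) z.
Proof.
move=> z0; elim: j => [|j ih]; first exact: cdif_id.
apply: (@cdif_comp _ (sqrtc_iter j) sqrtc) => //.
by apply: cdif_sqrtc; exact: Re_sqrtc_iter_gt0.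
Qed.

(** Along the segment from 0 to [w], cut into [n] equal parts, [f w] telescopes
into a product of ratios of consecutive values; these ratios are close to 1
when [n] is large, so each has a differentiable principal root. *)
Lemma cdif_root f r s j : (forall w, nc w < r -> cdif f w) ->
  (forall w, nc w < r -> f w != 0) -> f 0 = 1 -> 0 < s < r ->
  exists F, [/\ forall w, nc w < s -> cdif F w,
    forall w, nc w < s -> F w ^+ (2 ^ j) = f w & F 0 = 1].
Proof.
move=> df fn0 f0 sr; have /andP[s0 s1] := sr.
have [L L0 fL] := cauchy_lipschitz df sr.
have [K K0 fK] : exists2 K : R, 0 < K & forall w, nc w < s -> nc (f w)^-1 <= K.
  have dV w : nc w < r -> cdif (fun w => (f w)^-1) w.
    by move=> wr; apply: cdifV; [exact: fn0|exact: df].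
  have [L' L'0 fL'] := cauchy_lipschitz dV sr.
  exists (L' * s + 1) => [|w ws]; first by rewrite addr_gt0// mulr_gt0.
  have := fL' w 0 (ltW ws); rewrite nc0 subr0 f0 invr1 => /(_ (ltW s0)) h.
  have := le_nc_subl (f w)^-1 1; rewrite nc1.
  have : L' * nc w <= L' * s by rewrite ler_pM2l// ltW.
  by lra.
(* Consecutive values of [f] differ by at most [L * s / n], and [1 / f] is bounded
   by [K], so that the ratios are at distance less than 1 from 1. *)
pose n := (Num.truncn (L * s * K)).+1.
have n0 : 0 < n%:R :> R by [].
have nb : L * s * K / n%:R < 1.
  by rewrite ltr_pdivrMr// mul1r; exact: truncnS_gt.
pose c i : R[i] := (i%:R / n%:R : R)%:C.
pose q i w := f (c i.+1 * w) / f (c i * w).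
have cw i w : (i <= n)%N -> nc (c i * w) <= nc w.
  move=> ni; rewrite ncM nc_real ger0_norm ?divr_ge0// ler_piMl ?nc_ge0//.
  by rewrite ler_pdivrMr// mul1r ler_nat.
have qpos i w : (i < n)%N -> nc w < s -> 0 < Re (q i w).
  move=> ni ws.
  have h1 := cw _ w ni; have h2 := cw _ w (ltnW ni).
  have r2 : nc (c i * w) < r by lra.
  suff : nc (q i w - 1) < 1.
    by have := norm_Re_le (q i w - 1); rewrite ReB/= ler_norml => /andP[]; lra.
  rewrite /q (_ : _ - 1 = (f (c i.+1 * w) - f (c i * w)) / f (c i * w)); last first.
    by field; rewrite fn0.
  rewrite ncM; apply: le_lt_trans nb.
  rewrite mulrAC; apply: ler_pM; rewrite ?nc_ge0//; last by apply: fK; lra.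
  apply: le_trans (fL _ _ _ _) _; [lra|lra|].
  rewrite -mulrBl (_ : c i.+1 - c i = (n%:R^-1)%:C); last first.
    by rewrite /c -rmorphB/= -mulrBl -[i.+1]addn1 natrD addrAC subrr add0r mul1r.
  rewrite ncM nc_real ger0_norm ?invr_ge0// -mulrA ler_pM2l// mulrC.
  by rewrite ler_pM2r ?invr_gt0// ltW.
exists (fun w => \prod_(i < n) sqrtc_iter j (q i w)); split.
- move=> w ws; apply: (@cdif_prod _ _ (fun i w => sqrtc_iter j (q i w))) => i ni.
  have h1 := cw _ w ni; have h2 := cw _ w (ltnW ni).
  apply: cdif_comp; first by apply: cdif_sqrtc_iter; exact: qpos.
  have dl (k : R[i]) : cdif (fun w => k * w) w.
    by apply: cdifM; [exact: cdif_cst|exact: cdif_id].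
  apply: cdifM; first by apply: cdif_comp => //; apply: df; lra.
  apply: cdifV; first by apply: fn0; lra.
  by apply: cdif_comp => //; apply: df; lra.
- move=> w ws; rewrite -prodrXl.
  under eq_bigr do rewrite sqrtc_iter_exp.
  rewrite -(big_mkord xpredT (fun i => q i w)).
  rewrite (@telescope_prodf _ _ _ (fun i => f (c i * w)))//; last first.
    by move=> i /andP[_ /ltnW ni]; apply: fn0; have := cw _ w ni; lra.
  by rewrite /c mul0r mul0r f0 divff ?gt_eqF// mul1r divr1.
- rewrite big1// => i _; rewrite /q !mulr0 f0 divr1; exact: sqrtc_iter1.
Qed.

(** Passes from a bound on a root minus 1 to a bound on the function minus 1. *)
Lemma nc_exp1D_le (u : R[i]) (x : R) k : nc u <= x ->
  nc ((1 + u) ^+ k - 1) <= expR (k%:R * x) - 1.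
Proof.
move=> ux; have x0 : 0 <= x := le_trans (nc_ge0 _) ux.
suff h : nc ((1 + u) ^+ k - 1) <= (1 + x) ^+ k - 1.
  apply: le_trans h _; rewrite lerD2r expRM_natl.
  by apply: lerXn2r; rewrite ?nnegrE ?expR_ge0 ?expR_ge1Dx// addr_ge0.
elim: k => [|k ih]; first by rewrite !expr0 !subrr nc0.
rewrite !exprS.
have -> : (1 + u) * (1 + u) ^+ k - 1 = (1 + u) * ((1 + u) ^+ k - 1) + u by ring.
apply: le_trans (le_ncD _ _) _; rewrite ncM.
have u1 : nc (1 + u) <= 1 + x by apply: le_trans (le_ncD _ _) _; rewrite nc1 lerD2l.
have := ler_pM (nc_ge0 _) (nc_ge0 _) u1 ih; lra.
Qed.

Lemma expR_le1D2 (y : R) : 0 <= y <= 2^-1 -> expR y - 1 <= 2 * y.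
Proof.
move=> /andP[y0 y1]; have := expR_ge1Dx (- y); rewrite expRN => h.
have e0 := expR_gt0 y.
have : (1 - y) * expR y <= 1 by rewrite -ler_pdivlMr// mul1r.
nra.
Qed.

(** With a logarithm one would apply the Borel-Caratheodory inequality to it. A
root [F] of order [k >= 2 * A] plays its part: [Re (F w)] is at most [expR
(A / k)], which exceeds [F 0 = 1] by at most [2 * A / k]. *)
Lemma near1_of_bound f (A : R) r s z : 0 <= A -> (forall w, nc w < r -> cdif f w) ->
  (forall w, nc w < r -> f w != 0) -> f 0 = 1 ->
  (forall w, nc w < r -> nc (f w) <= expR A) -> nc z < s -> s < r ->
  nc (f z - 1) <= expR (8 * A * (nc z / (s - nc z))) - 1.
Proof.
move=> A0 df fn0 f0 fA zs sr; have s0 : 0 < s := le_lt_trans (nc_ge0 _) zs.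
have [t st tr] : exists2 t, s < t & t < r by exists ((s + r) / 2); lra.
(* [2 ^ j >= 2 * A] puts [A / 2 ^ j] in the range where [expR x - 1 <= 2 * x]. *)
pose j := (Num.truncn (2 * A)).+1.
have jA : 2 * A <= (2 ^ j)%:R.
  apply/ltW/(lt_le_trans (truncnS_gt _)); rewrite ler_nat.
  by apply: ltnW; exact: ltn_expl.
have k0 : 0 < (2 ^ j)%:R :> R by rewrite ltr0n expn_gt0.
have t0r : 0 < t < r by rewrite tr andbT; lra.
have [F [dF Ff F0]] := cdif_root j df fn0 f0 t0r.
move: (2 ^ j)%N jA k0 Ff => k jA k0 Ff {j}.
set q := nc z / (s - nc z).
have q0 : 0 <= q by rewrite divr_ge0 ?nc_ge0// subr_ge0 ltW.
have kn0 : (0 < k)%N by rewrite -(ltr0n R).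
have FB w : nc w = s -> Re (F w) <= expR (A / k%:R).
  move=> ws; apply: le_trans (Re_le_nc _) _; rewrite leNgt; apply/negP => h.
  have wt : nc w < t by rewrite ws.
  have wr : nc w < r by lra.
  have := fA w wr; rewrite -(Ff w wt) ncX leNgt => /negP; apply.
  have -> : expR A = expR (A / k%:R) ^+ k.
    by rewrite -expRM_natl mulrCA divff ?mulr1// gt_eqF.
  by rewrite ltrXn2r ?expR_ge0// lt0n_neq0.
have := borel_caratheodory dF zs st FB; rewrite F0 /= -/q => BC.
rewrite -Ff; last by lra.
rewrite -[F z](@subrK _ 1) (addrC (F z - 1)).
apply: le_trans (nc_exp1D_le k BC) _.
rewrite lerD2r ler_expR mulrA.
have Ak : expR (A / k%:R) - 1 <= 2 * (A / k%:R).
  apply: expR_le1D2; apply/andP; split; first exact: divr_ge0 A0 (ltW k0).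
  by rewrite ler_pdivrMr//; lra.
apply: ler_wpM2r => //.
have -> : 8 * A = k%:R * (4 * (2 * (A / k%:R))) by field; rewrite gt_eqF.
by rewrite ler_pM2l// ler_pM2l.
Qed.

End roots.

(** * Entire functions of order less than 1 *)

Section entire_functions.
Context {R : realType}.
Implicit Types (f g : R[i] -> R[i]) (z w : R[i]).

Lemma normr_nc z : `|z| = (nc z)%:C.
Proof. by rewrite normc_def; case: z. Qed.

Lemma derivable_approx f z : derivable (f : R[i]^o -> R[i]^o) z 1 ->
  forall e : R, 0 < e -> \forall w \near cnbhs z,
    nc (f w - (f z + derive1 (f : R[i]^o -> R[i]^o) z * (w - z))) <= e * nc (w - z).
Proof.
move=> df e e0; rewrite derive1E; set l := derive _ _ _.
have : h^-1 *: (f (h *: (1 : R[i]^o) + z) - f z : R[i]^o) @[h --> (0 : R[i]^o)^'] --> (l : R[i]^o).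
  exact: df.
have eC : (0 : R[i]) < e%:C by rewrite ltcR.
move/cvgrPdist_lt => /(_ _ eC) [d /= d0 dP].
have [d0r dE] : 0 < Re d /\ d = (Re d)%:C.
  by move: d0; rewrite ltcE /= => /andP[/eqP im re]; split => //; apply: Complex_eq.
exists (Re d) => // w wd; have [->|wz] := eqVneq w z.
  by rewrite subrr mulr0 addr0 subrr nc0 mulr0.
have wz0 : w - z != 0 by rewrite subr_eq0.
have := dP (w - z).
rewrite /= sub0r normrN normr_nc dE ltcR => /(_ wd wz0).
rewrite /GRing.scale/= mulr1 subrK normr_nc ltcR => h.
rewrite (_ : _ - _ = - (l - (w - z)^-1 * (f w - f z)) * (w - z)); last by field.
by rewrite ncM ncN ler_wpM2r ?nc_ge0// ltW.
Qed.

Lemma entire_cdif f : entire f -> forall z, cdif f z.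
Proof.
move=> ef z; apply/cdifP; eexists; exact: derivable_approx (ef z).
Qed.

Lemma cnbhs_punctured z (P : R[i] -> Prop) : (\forall w \near cnbhs z, P w) ->
  exists2 w, w != z & P w.
Proof.
move=> [d d0 dP]; exists (z + (d / 2)%:C).
  by rewrite -subr_eq0 addrAC subrr add0r -nc_gt0 nc_real normr_gt0 gt_eqF// divr_gt0.
by apply: dP; rewrite addrAC subrr add0r nc_real gtr0_norm ?divr_gt0//; lra.
Qed.

(** If [K c] were 0, then [f] would vanish at [c] to an order greater than one,
and its derivative there would be 0. *)
Lemma simple_zero_cofactor f K c : c != 0 ->
  derivable (f : R[i]^o -> R[i]^o) c 1 -> simple_zero f c ->
  ccont K c -> (forall w, f w = (1 - w / c) * K w) -> K c != 0.
Proof.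
move=> c0 df [fc +] cK fK; apply: contraNneq => Kc; set l := derive1 _ _.
have nc0' : 0 < nc c by rewrite nc_gt0.
rewrite -nc_eq0 eq_le nc_ge0 andbT; apply/ler_addgt0Pr => e e0; rewrite add0r.
have e20 : 0 < e / 2 by rewrite divr_gt0.
have ec0 : 0 < nc c * (e / 2) by rewrite mulr_gt0.
have H1 := derivable_approx df e20.
have H2 : \forall w \near cnbhs c, nc (K w) < nc c * (e / 2).
  by move: cK => /cvgc_lt /(_ _ ec0); apply: filterS => w; rewrite Kc subr0.
have [w wc [h1 h2]] := cnbhs_punctured (filterI H1 H2).
have wc0 : 0 < nc (w - c) by rewrite nc_gt0 subr_eq0.
rewrite -(ler_pM2r wc0) -ncM.
rewrite fc add0r -/l in h1.
have h3 : nc (f w) <= e / 2 * nc (w - c).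
  rewrite fK (_ : 1 - w / c = - (w - c) / c); last by field.
  have -> : e / 2 * nc (w - c) = nc (w - c) / nc c * (nc c * (e / 2)).
    by field; rewrite gt_eqF.
  by rewrite ncM ncM ncN ncV ler_wpM2l ?divr_ge0 ?nc_ge0// ltW.
have := le_nc_subl (l * (w - c)) (f w); rewrite ncBC; lra.
Qed.

Lemma max_modulus_ge f z : (forall w, cdif f w) ->
  nc (f z) <= max_modulus f (nc z).
Proof.
move=> df; apply: ub_le_sup; last by exists z.
have [|M fM] := @circle_bounded R f (nc z) (nc_ge0 z).
  by move=> w _; exact: cdif_ccont.
by exists M => _ [w wz <-]; exact: fM.
Qed.

(** For some [p < 1] one has [ln (max_modulus f r) <= r `^ p] for large [r], and
this is less than [e * r]. *)
Lemma growth_order_lt1 f : (forall w, cdif f w) -> (growth_order f < 1)%E ->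
  forall e : R, 0 < e -> exists r : R, forall z, r <= nc z ->
    nc (f z) <= expR (e * nc z).
Proof.
move=> df /ereal_inf_lt[_ [V V_oo <-]] V1 e e0.
have [p p1 pV] : exists2 p : R, p < 1 & forall r, V r ->
    ln (ln (max_modulus f r)) / ln r <= p.
  have Vp r : V r -> ((ln (ln (max_modulus f r)) / ln r)%:E <=
      ereal_sup [set (ln (ln (max_modulus f r)) / ln r)%:E | r in V])%E.
    by move=> Vr; apply: ereal_sup_ubound; exists r.
  move: V1 Vp; case: ereal_sup => [p||]//=.
    rewrite lte_fin => p1 Vp; exists p => // r /Vp; by rewrite lee_fin.
  by move=> _ Vp; exists 0 => // r /Vp; rewrite leeNy_eq.
case: V_oo => A [_ AV].
pose q := 1 - p; have q0 : 0 < q by rewrite subr_gt0.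
(* For [nc z >= r] the bound [p] applies, [ln (nc z)] is positive, and
   [p * ln (nc z) <= ln (e * nc z)]. *)
pose r := Num.max (A + 1) (Num.max (expR 1) (expR (- ln e / q))).
exists r => z; rewrite !ge_max => /and3P[zA z1 ze].
have z0 : 0 < nc z := lt_le_trans (expR_gt0 1) z1.
have lz : 1 <= ln (nc z) by rewrite -ler_expR lnK.
have lze : - ln e <= q * ln (nc z).
  by rewrite mulrC -ler_pdivrMr// -ler_expR [leRHS]lnK.
have := pV _ (AV (nc z) _); rewrite ler_pdivrMr; last lra.
move=> /(_ _) pz.
apply: le_trans (max_modulus_ge _ df) _.
set M := max_modulus f (nc z) in pz *.
have [M1|M1] := leP M 1.
  by apply: le_trans M1 _; rewrite -expR0 ler_expR mulr_ge0// ltW.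
have lM : 0 < ln M by rewrite ln_gt0.
rewrite -ler_ln ?posrE ?expR_gt0 ?expRK//; last lra.
rewrite -ler_ln ?posrE// ?mulr_gt0// lnM ?posrE//.
have {}pz : ln (ln M) <= p * ln (nc z) by apply: pz; lra.
by rewrite /q in lze; lra.
Qed.

End entire_functions.

(** * Factorization into a canonical product *)

Section factorization.
Context {R : realType}.
Variables (g : R[i] -> R[i]) (a : nat -> R).
Hypothesis g_cdif : forall z, cdif g z.
Hypothesis g0 : g 0 = 1.
Hypothesis a_incr : increasing_positive_seq a.
Hypothesis g_zeros : [set z | g z = 0] = range (fun n => (a n)%:C).
(* Simplicity of the zeros without derivatives, which carries over to the
   cofactor of a finite product. *)
Hypothesis g_simple : forall n K, ccont K (a n)%:C ->
  (forall w, g w = (1 - w / (a n)%:C) * K w) -> K (a n)%:C != 0.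
Hypothesis g_small : forall e : R, 0 < e -> exists r : R, forall z, r <= nc z ->
  nc (g z) <= expR (e * nc z).

Let a0 n : 0 < a n. Proof. by case: a_incr. Qed.

Let a_lt m n : (m < n)%N -> a m < a n.
Proof. by case: a_incr => _ /increasing_seqP ai _; rewrite (leW_mono ai). Qed.

Let aC0 n : (a n)%:C != 0 :> R[i].
Proof. by rewrite -nc_gt0 nc_real normr_gt0 gt_eqF. Qed.

Definition canonical_product N z : R[i] := \prod_(i < N) (1 - z / (a i)%:C).

Lemma canonical_productS N z : canonical_product N.+1 z = canonical_product N z * (1 - z / (a N)%:C).
Proof. by rewrite /canonical_product big_ord_recr. Qed.

Lemma canonical_product_neq0 N n : (N <= n)%N -> canonical_product N (a n)%:C != 0.
Proof.
move=> Nn; apply/prodf_neq0 => i _; rewrite subr_eq0 eq_sym.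
apply/eqP => /(canRL (divfK (aC0 i))); rewrite mul1r => /complexI aE.
by have := a_lt (leq_trans (ltn_ord i) Nn); rewrite aE ltxx.
Qed.

Lemma canonical_product_cofactor N : exists2 G, (forall z, cdif G z) &
  (forall z, g z = canonical_product N z * G z).
Proof.
elim: N => [|N [G dG gG]].
  by exists g => // z; rewrite /canonical_product big_ord0 mul1r.
have : G (a N)%:C = 0.
  have : g (a N)%:C = 0.
    by have : [set z | g z = 0] (a N)%:C by rewrite g_zeros; exists N.
  by move=> /eqP; rewrite gG mulf_eq0 (negbTE (canonical_product_neq0 (leqnn N))) => /eqP.
move=> /(divide_zero (aC0 N) dG)[H dH GH]; exists H => // z.
by rewrite gG GH canonical_productS mulrA.
Qed.

(** A zero of [G] in the disc would be one of the [a n] with [n < N], which the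
product already accounts for: it would be a multiple zero of [g]. *)
Lemma cofactor_neq0 N G z : (forall z, cdif G z) ->
  (forall z, g z = canonical_product N z * G z) -> nc z < a N -> G z != 0.
Proof.
move=> dG gG zN; apply/eqP => Gz.
have : [set z | g z = 0] z by rewrite /= gG Gz mulr0.
rewrite g_zeros => -[n _ nz]; rewrite -{}nz in Gz zN.
have nN : (n < N)%N.
  rewrite ltnNge; apply/negP => Nn; move: zN; rewrite nc_real gtr0_norm// ltNge.
  by move: Nn; rewrite leq_eqVlt => /predU1P[->|/a_lt/ltW->//]; rewrite lexx.
pose K w := (\prod_(i < N | i != Ordinal nN) (1 - w / (a i)%:C)) * G w.
suff : K (a n)%:C != 0 by rewrite /K Gz mulr0 eqxx.
apply: g_simple => [|w].
  apply: cvgcM; last exact: cdif_ccont.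
  rewrite /K; under eq_fun do rewrite big_mkcond/=.
  rewrite big_mkcond/=; apply: cdif_ccont.
  apply: (@cdif_prod _ _ (fun i w => if i != n then 1 - w / (a i)%:C else 1)) => i _ /=.
  case: (i != n); last exact: cdif_cst.
  apply: cdifB; first exact: cdif_cst.
  by apply: cdifM; [exact: cdif_id|exact: cdif_cst].
by rewrite gG /canonical_product (bigD1 (Ordinal nN))//= /K mulrA.
Qed.

(** On this circle [z / a i] has modulus at least 2 for every [i < N]. *)
Lemma canonical_product_circle_ge1 N z : nc z = 2 * a N -> 1 <= nc (canonical_product N z).
Proof.
move=> zN; suff : forall n, (n <= N)%N -> 1 <= nc (canonical_product n z) by apply.
elim=> [_|n ih nN].
  by rewrite /canonical_product big_ord0 nc1.
rewrite canonical_productS ncM; apply: mulr_ege1; first exact: ih (ltnW nN).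
have := le_nc_subl (z / (a n)%:C) 1; rewrite ncBC nc1 => h.
apply: le_trans h; rewrite ncM ncV nc_real gtr0_norm// zN.
by rewrite lerBrDr ler_pdivlMr// -[1 + 1]/2 ler_pM2l// ltW// a_lt.
Qed.

(** Bound [G] by [g] on the circle of radius [2 * a N], pass to the disc of
radius [a N] by the Cauchy bound, and apply [near1_of_bound] there with [s =
a N / 2]: the exponent is then small, as [A = 2 + 2 * d * a N]. *)
Lemma cofactor_near1 (e : R) z : 0 < e -> \forall N \near \oo,
  forall G, (forall z, cdif G z) -> (forall z, g z = canonical_product N z * G z) ->
    nc (G z - 1) < e.
Proof.
move=> e0; pose y := Num.min (e / 4) 2^-1.
have y0 : 0 < y by rewrite lt_min divr_gt0//=.
have nz1 : 0 < 64 * (nc z + 1) by rewrite mulr_gt0// ltr_wpDl// nc_ge0.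
(* Once [a N >= d^-1], the exponent in [near1_of_bound] is at most
   [128 * d * (nc z + 1) = y]. *)
pose d := y / (2 * (64 * (nc z + 1))).
have d0 : 0 < d by rewrite divr_gt0// mulr_gt0.
have [r gr] := g_small d0.
have a_oo : a n @[n --> \oo] --> +oo by case: a_incr.
have nearN : \forall N \near \oo,
    Num.max r (Num.max (4 * nc z + 1) (d^-1)) <= a N.
  by move/cvgryPge : a_oo; exact.
apply: filterS nearN => N; rewrite !ge_max => /and3P[aNr aNz aNd] G dG gG.
have aN := a0 N; pose A := 2 + 2 * d * a N.
have da : 0 < d * a N by rewrite mulr_gt0.
have A0 : 0 <= A by rewrite /A; lra.
have a2 : a N / 2 < a N by lra.
have za : nc z < a N / 2 by lra.
have G0 : G 0 = 1.
  have := gG 0; rewrite g0 /canonical_product big1 ?mul1r// => i _.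
  by rewrite mul0r subr0.
have GA w : nc w < a N -> nc (G w) <= expR A.
  move=> wN; have ws : nc w < 2 * a N by lra.
  have sr : 2 * a N < 2 * a N + 1 by rewrite ltrDl.
  have onS v : nc v = 2 * a N -> nc (G v) <= expR (d * (2 * a N)).
    move=> vN; apply: (@le_trans _ _ (nc (g v))).
      by rewrite gG ncM ler_peMl ?nc_ge0// canonical_product_circle_ge1.
    by rewrite -vN; apply: gr; rewrite vN; lra.
  apply: le_trans (cauchy_bound _ ws sr onS) _ => //.
  have q2 : 2 * a N / (2 * a N - nc w) <= 2 by rewrite ler_pdivrMr; lra.
  have e1 : 2 <= expR 1 :> R by have := expR_ge1Dx (1 : R); lra.
  have e2 : 4 <= expR 2 :> R.
    by rewrite (_ : 2 = 1 + 1 :> R)// expRD; nra.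
  rewrite /A expRD (_ : 2 * d * a N = d * (2 * a N)); last by ring.
  have E0 := expR_gt0 (d * (2 * a N)); move: (expR _) E0 => E E0.
  have := ler_wpM2l (ltW E0) q2; have := ler_wpM2r (ltW E0) e2; lra.
have GN w : nc w < a N -> G w != 0 by exact: cofactor_neq0.
have := near1_of_bound A0 (fun w _ => dG w) GN G0 GA za a2.
set q := nc z / _ => h; apply: le_lt_trans h _.
have q0 : 0 <= q by rewrite divr_ge0 ?nc_ge0//; lra.
have qa : q * a N <= 4 * nc z.
  rewrite /q mulrAC ler_pdivrMr; last lra.
  by rewrite -mulrA; have := nc_ge0 z; nra.
have qd : q <= 4 * nc z * d.
  have : 1 <= d * a N by rewrite mulrC -ler_pdivrMr// mul1r.
  have := ler_wpM2r (ltW d0) qa; nra.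
have Aq : 8 * A * q <= y.
  have -> : 8 * A * q = 16 * q + 16 * d * (q * a N) by rewrite /A; ring.
  have -> : y = 128 * (nc z + 1) * d by rewrite /d; field; rewrite gt_eqF// ltr_wpDl// nc_ge0.
  have := ler_wpM2l (ltW d0) qa; lra.
have Aq0 : 0 <= 8 * A * q by rewrite -mulrA; apply: mulr_ge0 => //; exact: (mulr_ge0 A0 q0).
have [y4 y2] : y <= e / 4 /\ y <= 2^-1 by rewrite /y !ge_min !lexx orbT.
apply: le_lt_trans (expR_le1D2 _) _; first by rewrite Aq0/= (le_trans Aq).
lra.
Qed.

Lemma cvgc_canonical_product z : cvgc \oo (fun N => canonical_product N z) (g z).
Proof.
have /choice[G GP] : forall N, exists G, (forall z, cdif G z) /\
    (forall z, g z = canonical_product N z * G z).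
  by move=> N; have [G dG gG] := canonical_product_cofactor N; exists G.
have G1 : cvgc \oo (fun N => G N z) 1.
  apply/cvgc_lt => e e0; apply: filterS (cofactor_near1 z e0) => N.
  by move=> /(_ (G N)); apply; case: (GP N).
have Gn0 : \forall N \near \oo, G N z != 0.
  move/cvgc_lt : G1 => /(_ 1 ltr01); apply: filterS => N.
  by apply: contraTneq => ->; rewrite sub0r ncN nc1 ltxx.
have : cvgc \oo (fun N => g z * (G N z)^-1) (g z).
  rewrite -[X in cvgc _ _ X]mulr1 -invr1; apply: cvgcM; first exact: cvgc_cst.
  by apply: cvgcV => //; exact: oner_neq0.
move=> /cvgc_nc h; apply/cvgc_nc; apply: cvg_trans h; apply: near_eq_cvg.
apply: filterS Gn0 => N GN0.
by rewrite {1}(GP N).2 mulfK.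
Qed.

End factorization.

(** * Expectations of bounded functions *)

Section bounded_expectation.
Context d (T : measurableType d) {R : realType} (P : probability T R).
Implicit Types (f g : T -> R).

Definition bdd_mfun f := measurable_fun setT f /\ exists M, forall x, `|f x| <= M.

Lemma bdd_mfun_integrable f : bdd_mfun f -> P.-integrable setT (EFin \o f).
Proof.
move=> [mf [M fM]]; apply: measurable_bounded_integrable => //.
  by rewrite ltey_eq fin_num_measure.
exists M; split; first exact: num_real.
by move=> N MN x _; exact: le_trans (fM x) (ltW MN).
Qed.

Lemma bdd_mfun_cst k : bdd_mfun (fun=> k).
Proof. by split; [exact: measurable_cst|exists `|k|]. Qed.

Lemma bdd_mfunD f g : bdd_mfun f -> bdd_mfun g -> bdd_mfun (fun x => f x + g x).
Proof.
move=> [mf [M fM]] [mg [N gN]]; split; first exact: measurable_funD.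
by exists (M + N) => x; apply: le_trans (ler_normD _ _) (lerD _ _).
Qed.

Lemma bdd_mfunM f g : bdd_mfun f -> bdd_mfun g -> bdd_mfun (fun x => f x * g x).
Proof.
move=> [mf [M fM]] [mg [N gN]]; split; first exact: measurable_funM.
by exists (M * N) => x; rewrite normrM ler_pM.
Qed.

Lemma bdd_mfunZ k f : bdd_mfun f -> bdd_mfun (fun x => k * f x).
Proof. by move=> bf; apply: bdd_mfunM => //; exact: bdd_mfun_cst. Qed.

Lemma expectD f g : bdd_mfun f -> bdd_mfun g ->
  \int[P]_x (f x + g x) = \int[P]_x f x + \int[P]_x g x.
Proof. by move=> bf bg; rewrite RintegralD//; exact: bdd_mfun_integrable. Qed.

Lemma expectB f g : bdd_mfun f -> bdd_mfun g ->
  \int[P]_x (f x - g x) = \int[P]_x f x - \int[P]_x g x.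
Proof. by move=> bf bg; rewrite RintegralB//; exact: bdd_mfun_integrable. Qed.

Lemma expectZ k f : bdd_mfun f -> \int[P]_x (k * f x) = k * \int[P]_x f x.
Proof. by move=> bf; rewrite RintegralZl//; exact: bdd_mfun_integrable. Qed.

Lemma expect_cst k : \int[P]_x k = k.
Proof. by rewrite Rintegral_cst//= probability_setT mulr1. Qed.

Lemma le_expect f g : bdd_mfun f -> bdd_mfun g -> (forall x, f x <= g x) ->
  \int[P]_x f x <= \int[P]_x g x.
Proof. by move=> bf bg fg; apply: le_Rintegral => //; exact: bdd_mfun_integrable. Qed.

Lemma EFin_expect f : bdd_mfun f -> (\int[P]_x (f x)%:E = (\int[P]_x f x)%:E)%E.
Proof.
move=> bf; rewrite /Rintegral fineK//.
by apply: integrable_fin_num => //; exact: bdd_mfun_integrable.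
Qed.

Lemma expect_indic A : measurable A -> \int[P]_x (\1_A x) = fine (P A).
Proof. by move=> mA; rewrite /Rintegral integral_indic// setIT. Qed.

Lemma bdd_mfun_indic A : measurable A -> bdd_mfun (\1_A : T -> R).
Proof.
move=> mA; split; first exact: measurable_indic.
by exists 1 => x; rewrite indicE ger0_norm// lern1 leq_b1.
Qed.

End bounded_expectation.

Lemma bdd_mfun_comp d1 d2 (T1 : measurableType d1) (T2 : measurableType d2) (R : realType)
  (f : T2 -> R) (phi : T1 -> T2) : measurable_fun setT phi -> bdd_mfun f ->
  bdd_mfun (fun x => f (phi x)).
Proof.
move=> mphi [mf [M fM]]; split; first exact: measurableT_comp.
by exists M.
Qed.

Lemma exists_law d1 d2 (T1 : measurableType d1) (T2 : measurableType d2) (R : realType)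
  (P : probability T1 R) (phi : T1 -> T2) : measurable_fun setT phi ->
  exists Q : probability T2 R, (forall A, Q A = P (phi @^-1` A)) /\
    forall f, bdd_mfun f -> \int[Q]_x f x = \int[P]_x f (phi x).
Proof.
move=> mphi; pose X : {mfun T1 >-> T2} := HB.pack phi (isMeasurableFun.Build _ _ _ _ phi mphi).
exists (distribution P X); split => // f bf.
rewrite /Rintegral integral_distribution//.
  by apply/measurable_EFinP; case: bf.
exact: (bdd_mfun_integrable P (bdd_mfun_comp mphi bf)).
Qed.

(** Independence of the two coordinates, by Fubini. *)
Lemma expect_prod d1 d2 (T1 : measurableType d1) (T2 : measurableType d2) (R : realType)
  (P : probability T1 R) (Q : probability T2 R) (u : T1 -> R) (v : T2 -> R) :
  bdd_mfun u -> bdd_mfun v ->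
  \int[(P \x Q)%E]_z (u z.1 * v z.2) = (\int[P]_x u x) * (\int[Q]_y v y).
Proof.
move=> bu bv; have buv : bdd_mfun (fun z : T1 * T2 => u z.1 * v z.2).
  by apply: bdd_mfunM; [exact: (bdd_mfun_comp measurable_fst)|exact: (bdd_mfun_comp measurable_snd)].
rewrite {1}/Rintegral -(integral12_prod_meas1 (bdd_mfun_integrable (P \x Q)%E buv)).
rewrite -[RHS]/(fine ((\int[P]_x u x) * (\int[Q]_y v y))%:E); congr fine.
rewrite mulrC -(expectZ P _ bu) -EFin_expect; last exact: bdd_mfunZ.
apply: eq_integral => x _; rewrite /fubini_F/= EFin_expect; last exact: bdd_mfunZ.
by rewrite expectZ// mulrC.
Qed.

Section mixture.
Context d (T : measurableType d) {R : realType}.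

(** The integral against a sum of measures is first computed for nonnegative
functions; a bounded function is nonnegative up to a constant. *)
Lemma exists_mixture (P Q : probability T R) (p : R) : 0 <= p <= 1 ->
  exists S : probability T R, (forall A, measurable A -> S A = (p%:E * P A + (1 - p)%:E * Q A)%E) /\
    forall f, bdd_mfun f -> \int[S]_x f x = p * \int[P]_x f x + (1 - p) * \int[Q]_x f x.
Proof.
move=> /andP[p0 p1]; have q0 : 0 <= 1 - p by rewrite subr_ge0.
pose m1 : {measure set T -> \bar R} := mscale (NngNum p0) P.
pose m2 : {measure set T -> \bar R} := mscale (NngNum q0) Q.
have mE A : measure_add m1 m2 A = (p%:E * P A + (1 - p)%:E * Q A)%E.
  by rewrite measure_addE.
have mT : measure_add m1 m2 setT = 1%E.
  by rewrite mE !probability_setT !mule1 -EFinD addrC subrK.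
pose m : {measure set T -> \bar R} := measure_add m1 m2.
pose S : probability T R := HB.pack (Measure.sort m)
  (Measure_isProbability.Build _ _ _ m mT).
exists S; split=> [A _|f bf]; first exact: mE.
have pos g : bdd_mfun g -> (forall x, 0 <= g x) ->
    \int[S]_x g x = p * \int[P]_x g x + (1 - p) * \int[Q]_x g x.
  move=> bg g0; have mg : measurable_fun setT (EFin \o g).
    by apply/measurable_EFinP; case: bg.
  rewrite {1}/Rintegral ge0_integral_measure_add//; last by move=> x _; rewrite lee_fin.
  rewrite !ge0_integral_mscale//; try by move=> x _; rewrite lee_fin.
  by rewrite !EFin_expect.
have [_ [M fM]] := bf.
have bM : bdd_mfun (fun x => f x + M) by apply: bdd_mfunD => //; exact: bdd_mfun_cst.
have fM0 x : 0 <= f x + M.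
  by rewrite -lerBlDr sub0r; have := fM x; rewrite ler_norml => /andP[].
have := pos _ bM fM0; rewrite !expectD ?expect_cst//; try exact: bdd_mfun_cst.
by move=> H; apply: (addIr M); rewrite H; ring.
Qed.

End mixture.

(** * The law of one factor *)

Section exponential_law.
Context {R : realType}.
Notation mu := (@lebesgue_measure R).

Lemma integral_density (P : probability (measurableTypeR R) R) (w f : R -> R) :
  mu.-integrable setT (EFin \o w) ->
  (forall A, measurable A -> P A = (\int[mu]_(x in A) (w x)%:E)%E) ->
  bdd_mfun f -> (\int[P]_x (f x)%:E = \int[mu]_x (f x * w x)%:E)%E.
Proof.
move=> iw Pw bf.
have mw : measurable_fun setT (EFin \o w) by exact: measurable_int iw.
have mf : measurable_fun setT (EFin \o f) by apply/measurable_EFinP; case: bf.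
have dom : P `<< mu.
  apply/null_content_dominatesP => A mA A0; rewrite Pw//.
  by apply: null_set_integral => //; exact: measurable_funTS.
rewrite -(Radon_Nikodym_change_of_variables dom)//=; last exact: bdd_mfun_integrable.
apply: ae_eq_integral => //.
- by apply: emeasurable_funM => //; apply: (measurable_int mu); exact: Radon_Nikodym_integrable.
- by under eq_fun do rewrite EFinM; exact: emeasurable_funM.
- under [X in ae_eq _ _ _ X]eq_fun do rewrite EFinM.
  apply: ae_eqe_mul2l => /=.
  apply: integral_ae_eq => //=; first exact: Radon_Nikodym_integrable.
  by move=> A _ mA; rewrite -Pw// -Radon_Nikodym_integral.
Qed.

Lemma cvg_expRN_oo (a : R) : 0 < a -> expR (- a * x) @[x --> +oo] --> (0 : R).
Proof.
move=> a0; rewrite (_ : (fun x => expR (- a * x)) = (fun z => expR (- z)) \o (fun z => a * z)).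
  apply: (@cvg_comp _ _ _ _ _ _ (pinfty_nbhs R)); last exact: cvgr_expR.
  exact: gt0_cvgMry.
by apply: funext => x /=; rewrite mulNr.
Qed.

(** Expectations under the exponential law through an antiderivative [H] of [f]
times the density, normalized to vanish at infinity. The derivative is
required only for [x > 0], as the functions [damp l] are not smooth at 0. *)
Lemma exists_exponential (a : R) : 0 < a ->
  exists E : probability (measurableTypeR R) R, E `]-oo, 0[%classic = 0%E /\
  forall f H : R -> R, bdd_mfun f -> continuous f ->
    {for 0, continuous H} ->
    (forall x : R, 0 < x -> is_derive x 1 H (f x * (a * expR (- a * x)))) ->
    H x @[x --> +oo] --> 0 -> \int[E]_x f x = - H 0.
Proof.
move=> a0.
have [E EE] : exists E : probability (measurableTypeR R) R,
    forall A, E A = exponential_prob a A.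
  unshelve eexists; first by unshelve refine (exponential_prob a : probability _ _).
  by [].
exists E; split.
  rewrite EE /exponential_prob integral0_eq// => x /=; rewrite in_itv/= => x0.
  by rewrite lt0_exponential_pdf.
have c_exp : continuous (fun x : R => expR (- a * x)).
  move=> x; apply: continuous_comp; last exact: continuous_expR.
  by apply: cvgM; [exact: cvg_cst|exact: cvg_id].
(* First for nonnegative [f], for which the improper integral converges
   monotonically; a bounded [f] is then shifted by a constant. *)
have pos (f H : R -> R) : bdd_mfun f -> (forall x, 0 <= f x) -> continuous f ->
    {for 0, continuous H} ->
    (forall x : R, 0 < x -> is_derive x 1 H (f x * (a * expR (- a * x)))) ->
    H x @[x --> +oo] --> 0 -> \int[E]_x f x = - H 0.
  move=> bf f0 cf cH dH Hoo; rewrite /Rintegral.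
  have EA A : measurable A -> E A = (\int[mu]_(x in A) (exponential_pdf a x)%:E)%E.
    by move=> _; exact: EE.
  rewrite (integral_density (integrable_exponential_pdf a0) EA bf).
  rewrite (_ : (\int[mu]_x _)%E = (\int[mu]_(x in `[0%R, +oo[) (f x * (a * expR (- a * x)))%:E)%E).
    rewrite (@ge0_continuous_FTC2y _ _ H _ 0)//.
    - by rewrite sub0e.
    - by move=> x _; rewrite !mulr_ge0 ?expR_ge0// ltW.
    - apply: continuous_subspaceT => x; apply: cvgM; first exact: cf.
      by apply: cvgM; [exact: cvg_cst|exact: c_exp].
    - by move=> x /dH[].
    - exact: cvg_at_right_filter.
    - by move=> x; rewrite in_itv/= andbT => /dH[_ <-]; rewrite derive1E.
  rewrite [RHS]integral_mkcond/=; apply: eq_integral => x _.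
  rewrite patchE /exponential_pdf patchE; case: ifPn => _ //.
  by rewrite mulr0.
move=> f H bf cf cH dH Hoo; have [_ [M fM]] := bf.
have bM : bdd_mfun (fun x : measurableTypeR R => f x + M) by apply: bdd_mfunD => //; exact: bdd_mfun_cst.
have fM0 x : 0 <= f x + M.
  by rewrite -lerBlDr sub0r; have := fM x; rewrite ler_norml => /andP[].
have cM : continuous (fun x => f x + M).
  by move=> x; apply: cvgD; [exact: cf|exact: cvg_cst].
have dM (x : R) : 0 < x -> is_derive x 1 (fun x => H x - M * expR (- a * x))
    ((f x + M) * (a * expR (- a * x))).
  move=> /dH dHx; apply: is_derive_eq.
  by rewrite /GRing.scale/=; ring.
have HM : H x - M * expR (- a * x) @[x --> +oo] --> 0.
  rewrite -[X in _ --> X](subr0 0) -{2}(mulr0 M).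
  apply: cvgB => //; apply: cvgM; first exact: cvg_cst.
  exact: cvg_expRN_oo.
have cHM : {for 0, continuous (fun x => H x - M * expR (- a * x))}.
  by apply: cvgB => //; apply: cvgM; [exact: cvg_cst|exact: c_exp].
have := pos _ _ bM fM0 cM cHM dM HM.
rewrite expectD//; last exact: bdd_mfun_cst.
rewrite expect_cst mulr0 expR0 mulr1 => h; apply: (addIr M); rewrite h; ring.
Qed.

Lemma cvg_expRN_bounded (a M : R) (f : R -> R) : 0 < a -> (forall x, `|f x| <= M) ->
  expR (- a * x) * f x @[x --> +oo] --> (0 : R).
Proof.
move=> a0 fM; apply/cvgr0Pnorm_lt => e e0.
have M0 : 0 < M + 1 by rewrite ltr_wpDl// (le_trans _ (fM 0)).
have := cvg_expRN_oo a0 => /cvgr0Pnorm_lt /(_ (e / (M + 1)) (divr_gt0 e0 M0)).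
apply: filterS => x; rewrite ger0_norm ?expR_ge0// => h.
rewrite normrM ger0_norm ?expR_ge0//.
have : expR (- a * x) * `|f x| <= expR (- a * x) * (M + 1).
  by rewrite ler_wpM2l ?expR_ge0// (le_trans (fM x))// lerDl.
by move=> /le_lt_trans; apply; rewrite -ltr_pdivlMr.
Qed.

Lemma bdd_mfun_cos (t : R) : bdd_mfun (fun x : measurableTypeR R => cos (t * x)).
Proof.
split; last by exists 1 => x; rewrite ler_norml cos_geN1 cos_le1.
apply: continuous_measurable_fun => x; apply: continuous_comp; last exact: continuous_cos.
by apply: cvgM; [exact: cvg_cst|exact: cvg_id].
Qed.

Lemma bdd_mfun_sin (t : R) : bdd_mfun (fun x : measurableTypeR R => sin (t * x)).
Proof.
split; last by exists 1 => x; rewrite ler_norml sin_geN1 sin_le1.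
apply: continuous_measurable_fun => x; apply: continuous_comp; last exact: continuous_sin.
by apply: cvgM; [exact: cvg_cst|exact: cvg_id].
Qed.

(** One minus the Laplace kernel. It is bounded and subadditive, so that its
expectation is a substitute for the mean in the control of sums, and it is
close to 1 far from 0, so that it controls tails. *)
Definition damp (l x : R) : R := 1 - expR (- l * `|x|).

Lemma continuous_damp l : continuous (damp l).
Proof.
move=> x; apply: cvgB; first exact: cvg_cst.
apply: continuous_comp; last exact: continuous_expR.
by apply: cvgM; [exact: cvg_cst|exact: norm_continuous].
Qed.

Lemma damp_ge0 l x : 0 <= l -> 0 <= damp l x.
Proof.
by move=> l0; rewrite subr_ge0 -expR0 ler_expR mulNr oppr_le0 mulr_ge0.
Qed.

Lemma bdd_mfun_damp l : 0 <= l -> bdd_mfun (damp l : measurableTypeR R -> R).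
Proof.
move=> l0; split; first by apply: continuous_measurable_fun; exact: continuous_damp.
by exists 1 => x; rewrite ger0_norm ?damp_ge0// /damp gerBl expR_ge0.
Qed.

Lemma damp_subadditive l x y : 0 <= l -> damp l (x + y) <= damp l x + damp l y.
Proof.
move=> l0; apply: (@le_trans _ _ (1 - expR (- l * `|x|) * expR (- l * `|y|))).
  rewrite lerD2l lerN2 -expRD ler_expR -mulrDr !mulNr lerN2.
  by rewrite ler_wpM2l// ler_normD.
have := damp_ge0 x l0; have := damp_ge0 y l0; rewrite /damp.
by move: (expR _) (expR _) => u v; nra.
Qed.

(** The mixture of the point mass at 0 with weight [a / b] and of the
exponential law of rate [a]. Its characteristic function is [a / b + (1 - a
/ b) / (1 - it / a)], which is the stated quotient. *)
Lemma exists_factor_law (a b : R) : 0 < a < b ->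
  exists P : probability (measurableTypeR R) R, [/\ P `]-oo, 0[%classic = 0%E,
  forall t, characteristic_function P t =
    (1 - (0 +i* t) / b%:C) / (1 - (0 +i* t) / a%:C) &
  forall l, 0 < l -> \int[P]_x damp l x <= l / a].
Proof.
move=> /andP[a0 ab]; have b0 := lt_trans a0 ab.
have [E [E0 EH]] := exists_exponential a0.
have p01 : 0 <= a / b <= 1.
  by apply/andP; split; [exact: divr_ge0 (ltW a0) (ltW b0)|rewrite ler_pdivrMr// mul1r ltW].
have [P [PA Pf]] := exists_mixture (\d_(0 : measurableTypeR R) : probability _ R) E p01.
have Ex0 (f : measurableTypeR R -> R) : bdd_mfun f -> \int[\d_(0 : measurableTypeR R)]_x f x = f 0.
  move=> [mf _]; rewrite /Rintegral integral_dirac//; last exact/measurable_EFinP.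
  by rewrite diracT mul1e.
exists P; split.
- rewrite PA// E0 mule0 adde0 /= /dirac indicE (_ : (0 \in _) = false) ?mule0//.
  by apply/negbTE; rewrite notin_setE/= in_itv/= ltxx.
- move=> t; pose k := (a ^+ 2 + t ^+ 2)^-1.
  have k0 : a ^+ 2 + t ^+ 2 != 0 by rewrite gt_eqF// ltr_pwDl ?exprn_gt0 ?sqr_ge0.
  have bd (u v x : R) : `|(u * cos (t * x) + v * sin (t * x)) * k| <= (`|u| + `|v|) * `|k|.
    rewrite normrM ler_wpM2r//; apply: le_trans (ler_normD _ _) _.
    by rewrite !normrM; apply: lerD; rewrite ler_piMr// ler_norml ?cos_geN1 ?cos_le1 ?sin_geN1 ?sin_le1.
  have ct : continuous (fun x : R => t * x).
    by move=> x; apply: cvgM; [exact: cvg_cst|exact: cvg_id].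
  (* [- expR (- a * x) * (u * cos (t * x) + v * sin (t * x)) * k] is an
     antiderivative of [f x * (a * expR (- a * x))]; its value at 0 is [- u * k].
     Suitable [u] and [v] give the cosine and the sine. *)
  have Eh (f : R -> R) (u v : R) : bdd_mfun (f : measurableTypeR R -> R) -> continuous f ->
      (forall x, f x = (u * (a * cos (t * x) + t * sin (t * x)) +
                        v * (a * sin (t * x) - t * cos (t * x))) * k / a) ->
      \int[E]_x f x = u * k.
    move=> bf cf fE.
    pose H x := - (expR (- a * x) * ((u * cos (t * x) + v * sin (t * x)) * k)).
    have dH (x : R) : is_derive x 1 H (f x * (a * expR (- a * x))).
      rewrite fE /H; apply: is_derive_eq.
      by rewrite scaler0 add0r /GRing.scale/= !mulr1; field; rewrite gt_eqF.
    have cH : {for 0, continuous H}.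
      by apply: differentiable_continuous; apply/derivable1_diffP; case: (dH 0).
    have Hoo : H x @[x --> +oo] --> 0.
      by rewrite -oppr0; apply: cvgN; apply: cvg_expRN_bounded => // x; exact: bd.
    rewrite (EH f H bf cf cH (fun x _ => dH x) Hoo).
    by rewrite /H !mulr0 expR0 cos0 sin0 mulr1 mulr0 addr0 mul1r opprK.
  have Ec : \int[E]_x cos (t * x) = a ^+ 2 * k.
    rewrite (Eh (fun x => cos (t * x)) (a ^+ 2) (- (a * t))) => [//| | |x].
    - exact: bdd_mfun_cos.
    - by move=> x; apply: continuous_comp; [exact: ct|exact: continuous_cos].
    - by rewrite /k; field; rewrite k0 gt_eqF.
  have Es : \int[E]_x sin (t * x) = a * t * k.
    rewrite (Eh (fun x => sin (t * x)) (a * t) (a ^+ 2)) => [//| | |x].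
    - exact: bdd_mfun_sin.
    - by move=> x; apply: continuous_comp; [exact: ct|exact: continuous_sin].
    - by rewrite /k; field; rewrite k0 gt_eqF.
  rewrite /characteristic_function !Pf; [|exact: bdd_mfun_sin|exact: bdd_mfun_cos].
  rewrite !Ex0; [|exact: bdd_mfun_sin|exact: bdd_mfun_cos].
  rewrite mulr0 cos0 sin0 Ec Es.
  have dr (x : R) : (0 +i* t) / x%:C = 0 +i* (t / x).
    by rewrite -fmorphV/=; apply: Complex_eq; rewrite ?ReM ?ImM/=; ring.
  rewrite !dr; have az : 1 - 0 +i* (t / a) != 0 :> R[i].
    by apply/eqP => /(congr1 (@complex.Re R))/=; rewrite subr0 => /eqP; rewrite oner_eq0.
  apply: (mulIf az); rewrite divfK// /k; apply: Complex_eq => /=.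
    by field; rewrite k0 !gt_eqF.
  by field; rewrite k0 !gt_eqF.
- move=> l l0.
  have al0 : 0 < a + l by rewrite addr_gt0.
  rewrite Pf; last exact: bdd_mfun_damp (ltW l0).
  rewrite Ex0; last exact: bdd_mfun_damp (ltW l0).
  rewrite {1}/damp normr0 mulr0 expR0 subrr mulr0 add0r.
  pose H x := - expR (- a * x) + a / (a + l) * expR (- (a + l) * x).
  have dH' (x : R) : is_derive x 1 H (a * expR (- a * x) - a * expR (- (a + l) * x)).
    rewrite /H; apply: is_derive_eq.
    by rewrite /GRing.scale/= !mulr1; field; rewrite gt_eqF.
  have dH (x : R) : 0 < x -> is_derive x 1 H (damp l x * (a * expR (- a * x))).
    move=> x0; apply: (is_derive_eq (dH' x)); rewrite /damp gtr0_norm//.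
    by rewrite mulrBl mul1r mulrCA -expRD; congr (_ - _ * expR _); ring.
  have cH : {for 0, continuous H}.
    by apply: differentiable_continuous; apply/derivable1_diffP; case: (dH' 0).
  have Hoo : H x @[x --> +oo] --> 0.
    rewrite -[X in _ --> X](addr0 0) -{1}oppr0 -{2}(mulr0 (a / (a + l))).
    by apply: cvgD; [apply: cvgN|apply: cvgM; first exact: cvg_cst]; exact: cvg_expRN_oo.
  rewrite (EH _ H (bdd_mfun_damp (ltW l0)) (@continuous_damp l) cH dH Hoo).
  rewrite /H !mulr0 expR0 mulr1.
  have -> : - (-1 + a / (a + l)) = l / (a + l) by field; rewrite gt_eqF.
  have [/andP[p0 p1] la] : 0 <= a / b <= 1 /\ l / (a + l) <= l / a.
    by split => //; rewrite ler_pM2l// lef_pV2 ?posrE// lerDl ltW.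
  apply: le_trans la; apply: ler_piMl; first exact: divr_ge0 (ltW l0) (ltW al0).
  by rewrite gerBl.
Qed.

End exponential_law.

(** * Sums of independent variables *)

Section convolution.
Context {R : realType}.
Notation law := (probability (measurableTypeR R) R).

(** The law of the sum of independent variables with laws [P] and [Q]; the
second one being nonnegative, the sum is larger than the first. *)
Lemma exists_convolution (P Q : law) : Q `]-oo, 0[%classic = 0%E ->
  exists S : law, [/\ forall t, characteristic_function S t =
      characteristic_function P t * characteristic_function Q t,
    forall x, (S `]-oo, x]%classic <= P `]-oo, x]%classic)%E,
    P `]-oo, 0[%classic = 0%E -> S `]-oo, 0[%classic = 0%E &
    forall l, 0 <= l -> \int[S]_x damp l x <= \int[P]_x damp l x + \int[Q]_x damp l x].
Proof.
move=> Q0; pose PQ : probability _ R := (P \x Q)%E.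
pose add (z : measurableTypeR R * measurableTypeR R) : measurableTypeR R := z.1 + z.2 : R.
have madd : measurable_fun setT add.
  by apply: measurable_funD; [exact: measurable_fst|exact: measurable_snd].
have [S [SA Sf]] := exists_law PQ madd.
have m1 (A : set (measurableTypeR R)) : measurable A -> PQ (A `*` setT) = P A.
  move=> mA; transitivity (P A * Q setT)%E; first exact: product_measure1E.
  by rewrite probability_setT mule1.
have m2 (A : set (measurableTypeR R)) : measurable A -> PQ (setT `*` A) = Q A.
  move=> mA; transitivity (P setT * Q A)%E; first exact: product_measure1E.
  by rewrite probability_setT mul1e.
have mpre (A : set (measurableTypeR R)) : measurable A -> measurable (add @^-1` A).
  by move=> mA; rewrite -[X in measurable X]setTI; exact: madd.
(* The second coordinate is almost surely nonnegative. *)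
have shift (A B : set (measurableTypeR R)) : measurable A -> measurable B ->
    (forall x y : R, 0 <= y -> A (x + y) -> B x) -> (S A <= P B)%E.
  move=> mA mB AB; rewrite SA -(m1 B mB) -[leRHS]adde0 -Q0 -m2//.
  apply: le_trans (measureU2 _ _ _); try exact: measurableX.
  apply: le_measure; rewrite ?inE; first exact: mpre.
    by apply: measurableU; exact: measurableX.
  move=> [x y] /= Axy; have [y0|y0] := leP 0 y.
    by left; split => //; exact: AB Axy.
  by right; split => //=; rewrite in_itv.
exists S; split.
- move=> t; have bc := bdd_mfun_cos t; have bs := bdd_mfun_sin t.
  have b1 (f : measurableTypeR R -> R) : bdd_mfun f -> bdd_mfun (fun z : measurableTypeR R * measurableTypeR R => f z.1).
    by move=> bf; exact: (bdd_mfun_comp measurable_fst bf).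
  have b2 (f : measurableTypeR R -> R) : bdd_mfun f -> bdd_mfun (fun z : measurableTypeR R * measurableTypeR R => f z.2).
    by move=> bf; exact: (bdd_mfun_comp measurable_snd bf).
  rewrite /characteristic_function; apply: Complex_eq; rewrite ?ReM ?ImM/=.
    rewrite (Sf _ bc) -(expect_prod P Q bc bc) -(expect_prod P Q bs bs) -(expectB PQ); last 2 first.
    - exact: (bdd_mfunM (b1 _ bc) (b2 _ bc)).
    - exact: (bdd_mfunM (b1 _ bs) (b2 _ bs)).
    by apply: eq_Rintegral => z _; rewrite /add mulrDr cosD.
  rewrite (Sf _ bs) -(expect_prod P Q bc bs) -(expect_prod P Q bs bc) -(expectD PQ); last 2 first.
  - exact: (bdd_mfunM (b1 _ bc) (b2 _ bs)).
  - exact: (bdd_mfunM (b1 _ bs) (b2 _ bc)).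
  by apply: eq_Rintegral => z _; rewrite /add mulrDr sinD addrC.
- move=> x; apply: shift => // u v v0 /=; rewrite !in_itv/=; lra.
- move=> P0; apply/eqP; rewrite eq_le measure_ge0 andbT -P0.
  by apply: shift => // u v v0 /=; rewrite !in_itv/=; lra.
- move=> l l0; have bd := bdd_mfun_damp l0; rewrite (Sf _ bd).
  have b1 : bdd_mfun (fun z : measurableTypeR R * measurableTypeR R => damp l z.1).
    exact: (bdd_mfun_comp measurable_fst bd).
  have b2 : bdd_mfun (fun z : measurableTypeR R * measurableTypeR R => damp l z.2).
    exact: (bdd_mfun_comp measurable_snd bd).
  have -> : \int[P]_x damp l x = \int[PQ]_z damp l z.1.
    rewrite -[LHS]mulr1 -(expect_cst Q 1) -expect_prod//; last exact: bdd_mfun_cst.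
    by apply: eq_Rintegral => z _; rewrite mulr1.
  have -> : \int[Q]_x damp l x = \int[PQ]_z damp l z.2.
    rewrite -[LHS]mul1r -(expect_cst P 1) -expect_prod//; last exact: bdd_mfun_cst.
    by apply: eq_Rintegral => z _; rewrite mul1r.
  rewrite -expectD//; apply: le_expect; first exact: bdd_mfun_comp.
    exact: bdd_mfunD.
  by move=> z; exact: damp_subadditive.
Qed.

Lemma exists_partial_laws (a b : nat -> R) : (forall n, 0 < a n) -> (forall n, a n < b n) ->
  exists P : nat -> law, [/\ forall n, P n `]-oo, 0[%classic = 0%E,
    forall n t, characteristic_function (P n) t =
      canonical_product b n (0 +i* t) / canonical_product a n (0 +i* t),
    forall n x, (P n.+1 `]-oo, x]%classic <= P n `]-oo, x]%classic)%E &
    forall n l, 0 < l -> \int[P n]_x damp l x <= \sum_(i < n) l / a i].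
Proof.
move=> a0 ab.
have /choice[Q QP] n := @exists_factor_law R (a n) (b n) (introT andP (conj (a0 n) (ab n))).
have Q0 n : Q n `]-oo, 0[%classic = 0%E by case: (QP n).
have /choice[next nextP] : forall nP : nat * law, exists S : law,
    [/\ forall t, characteristic_function S t =
      characteristic_function nP.2 t * characteristic_function (Q nP.1) t,
    forall x, (S `]-oo, x]%classic <= nP.2 `]-oo, x]%classic)%E,
    nP.2 `]-oo, 0[%classic = 0%E -> S `]-oo, 0[%classic = 0%E &
    forall l, 0 <= l -> \int[S]_x damp l x <=
      \int[nP.2]_x damp l x + \int[Q nP.1]_x damp l x].
  by move=> [n P]; exact: exists_convolution.
pose D : law := \d_(0 : measurableTypeR R).
pose P := fix P n := if n is m.+1 then next (m, P m) else D.
have ED (f : measurableTypeR R -> R) : bdd_mfun f -> \int[D]_x f x = f 0.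
  move=> [mf _]; rewrite /Rintegral integral_dirac//; last exact/measurable_EFinP.
  by rewrite diracT mul1e.
exists P; split.
- elim=> [|n ih]; last by have [_ _ /(_ ih)] := nextP (n, P n).
  rewrite /= /dirac indicE (_ : (0 \in _) = false)//.
  by apply/negbTE; rewrite notin_setE/= in_itv/= ltxx.
- move=> n t; elim: n => [|n ih].
    rewrite /canonical_product !big_ord0 divr1 /characteristic_function !ED; last 2 first.
    + exact: bdd_mfun_sin.
    + exact: bdd_mfun_cos.
    by rewrite mulr0 cos0 sin0.
  have [-> _ _ _] := nextP (n, P n); rewrite /= ih; have [_ -> _] := QP n.
  by rewrite !canonical_productS -mulf_div.
- by move=> n; have [_ + _ _] := nextP (n, P n).
- move=> n l l0; elim: n => [|n ih].
    by rewrite ED ?big_ord0 /damp ?normr0 ?mulr0 ?expR0 ?subrr//; exact: bdd_mfun_damp (ltW l0).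
  have [_ _ _ /(_ l (ltW l0)) h] := nextP (n, P n).
  apply: le_trans h _; rewrite big_ord_recr/=; apply: lerD => //.
  by have [_ _] := QP n; apply.
Qed.

End convolution.

(** * Quantiles and limits of decreasing distribution functions *)

Section quantile.
Context {R : realType}.
Notation law := (probability (measurableTypeR R) R).
Implicit Types P Q : law.

Definition distr P (x : R) : R := fine (P `]-oo, x]%classic).

Lemma distrE P x : P `]-oo, x]%classic = (distr P x)%:E.
Proof. by rewrite /distr fineK// fin_num_measure. Qed.

Lemma distr_ge0 P x : 0 <= distr P x.
Proof. by rewrite fine_ge0. Qed.

Lemma distr_le1 P x : distr P x <= 1.
Proof. by rewrite -lee_fin -distrE probability_le1. Qed.

Lemma distr_mono P x y : x <= y -> distr P x <= distr P y.
Proof.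
move=> xy; rewrite -lee_fin -!distrE le_measure ?inE//.
by move=> u /=; rewrite !in_itv/= => /le_trans; apply.
Qed.

(** The half-lines generate the Borel sets and are stable under intersection. *)
Lemma distr_eq P Q : (forall x, distr P x = distr Q x) ->
  forall A, measurable A -> P A = Q A.
Proof.
move=> PQ A mA; apply: (@measure_unique _ R (measurableTypeR R) (@RGenOInfty.G R) (fun n => `](- n%:R : R), +oo[%classic) _ _ _ _ P Q) => //.
- exact: RGenOInfty.measurableE.
- move=> _ _ [x ->] [y ->]; exists (Num.max x y).
  by apply/seteqP; split => z /=; rewrite !in_itv/= !andbT gt_max; [case=> -> ->|move=> /andP[]].
- by move=> n; exists (- n%:R).
- apply/seteqP; split => // x _; exists (Num.truncn `|x|).+1 => //=.
  rewrite in_itv/= andbT ltrNl; apply: le_lt_trans (truncnS_gt _).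
  by rewrite -normrN ler_norm.
- move=> _ [x ->]; have PC (S : law) : S `]x, +oo[%classic = (1 - S `]-oo, x]%classic)%E.
    by rewrite -probability_setC// setCitvl.
  by apply: (etrans (PC P)); apply: (etrans _ (esym (PC Q))); rewrite !distrE PQ.
- by move=> n; rewrite ltey_eq fin_num_measure.
Qed.

(** A distribution function tends to 1 at infinity. *)
Lemma distr_ge_ex P u : u < 1 -> exists x, u <= distr P x.
Proof.
move=> u1; have : P `]-oo, n%:R]%classic @[n --> \oo] --> (1%:E : \bar R).
  rewrite -(probability_setT P) -(_ : \bigcup_n `]-oo, n%:R]%classic = setT).
    apply: nondecreasing_cvg_mu => //; first exact: bigcup_measurable.
    move=> n m nm; apply/subsetPset => x /=; rewrite !in_itv/= => /le_trans; apply.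
    by rewrite ler_nat.
  apply/seteqP; split => // x _; exists (Num.truncn `|x|).+1 => //=.
  by rewrite in_itv/= (le_trans (ler_norm x))// ltW// truncnS_gt.
under eq_fun do rewrite distrE.
move=> /fine_cvgP[_] /= /cvgrPdist_lt/(_ (1 - u)); rewrite subr_gt0 => /(_ u1)[n _ /(_ n (leqnn n))].
by move=> /= h; exists n%:R; have := ler_norm (1 - distr P n%:R); lra.
Qed.

(** Right continuity of a distribution function. *)
Lemma distr_right P u x : (forall n, u <= distr P (x + n.+1%:R^-1)) -> u <= distr P x.
Proof.
move=> ux; have : P `]-oo, (x + n.+1%:R^-1)]%classic @[n --> \oo] --> P `]-oo, x]%classic.
  rewrite (_ : `]-oo, x]%classic = \bigcap_n `]-oo, (x + n.+1%:R^-1)]%classic).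
    apply: nonincreasing_cvg_mu => //.
    - by rewrite ltey_eq fin_num_measure.
    - exact: bigcap_measurable.
    - move=> n m nm; apply/subsetPset => y /=; rewrite !in_itv/= => /le_trans; apply.
      by rewrite lerD2l lef_pV2 ?posrE// ler_nat.
  apply/seteqP; split => y /=.
    by rewrite in_itv/= => yx n _ /=; rewrite in_itv/= (le_trans yx)// lerDl.
  move=> h; rewrite in_itv/= leNgt; apply/negP => /ltr_add_invr[n nx].
  by have := h n Logic.I; rewrite /= in_itv/= leNgt nx.
under eq_fun do rewrite distrE; rewrite distrE => /fine_cvgP[_] /= h.
rewrite leNgt; apply/negP => ltu; move/cvgrPdist_lt: h => /(_ (u - distr P x)).
rewrite subr_gt0 => /(_ ltu)[n _ /(_ n (leqnn n))] /= h.
have := ux n; have := ler_norm (- (distr P x - distr P (x + n.+1%:R^-1))).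
by rewrite normrN; lra.
Qed.

(** The left-continuous inverse of the distribution function. *)
Definition quantile P (u : R) : R := inf [set x | u <= distr P x].

Lemma distr_neg P x : P `]-oo, 0[%classic = 0%E -> x < 0 -> distr P x = 0.
Proof.
move=> P0 x0; have : (P `]-oo, x]%classic <= P `]-oo, 0%R[%classic)%E.
  by rewrite le_measure ?inE// => v /=; rewrite !in_itv/=; lra.
by rewrite P0 distrE lee_fin => h; apply/eqP; rewrite eq_le h distr_ge0.
Qed.

Lemma quantileP P u x : P `]-oo, 0[%classic = 0%E -> 0 < u < 1 ->
  (quantile P u <= x) = (u <= distr P x).
Proof.
move=> P0 /andP[u0 u1].
have lb y : u <= distr P y -> 0 <= y.
  move=> uy; rewrite leNgt; apply/negP => y0.
  by have := distr_neg P0 y0; lra.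
have ne : [set y | u <= distr P y] !=set0 by have [y uy] := distr_ge_ex P u1; exists y.
have hl : has_lbound [set y | u <= distr P y] by exists 0 => y /lb.
apply/idP/idP => [qx|ux]; last by apply: ge_inf.
apply: le_trans (distr_mono P qx).
apply: distr_right => n.
have hi : has_inf [set y | u <= distr P y] by split.
have n0 : 0 < n.+1%:R^-1 :> R by rewrite invr_gt0.
have [y uy yq] := inf_adherent n0 hi.
by apply: le_trans uy _; apply: distr_mono; exact: ltW.
Qed.

Definition unif : law := uniform_prob (@ltr01 R).

(** The value 0 outside the open unit interval keeps the monotonicity in the law
and the nonnegativity valid at every [u]. *)
Definition quantile01 P (u : R) : R := if 0 < u < 1 then quantile P u else 0.

Lemma quantile01_preimage P x : P `]-oo, 0[%classic = 0%E ->
  quantile01 P @^-1` `]-oo, x] =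
    (`]0, 1[ `&` `]-oo, distr P x]) `|` (~` `]0, 1[ `&` [set _ | 0 <= x]).
Proof.
move=> P0; apply/seteqP; split => u; rewrite /= !in_itv/= /quantile01; case: ifPn => u01.
- by rewrite quantileP//; left.
- by right.
- by rewrite quantileP// => -[[]|[]].
- by move=> [[]|[]].
Qed.

Lemma measurable_quantile01 P : P `]-oo, 0[%classic = 0%E ->
  measurable_fun setT (quantile01 P : measurableTypeR R -> measurableTypeR R).
Proof.
move=> P0; apply: (measurability (@RGenOInfty.G R)) => [|/= _ [_] [x] -> <-].
  exact: RGenOInfty.measurableE.
rewrite setTI -setCitvl preimage_setC; apply: measurableC.
rewrite [X in measurable X](quantile01_preimage x P0); apply: measurableU; apply: measurableI => //.
  exact: measurableC.
have [x0|x0] := leP 0 x.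
  by rewrite (_ : [set _ | _] = setT)//; apply/seteqP.
by rewrite (_ : [set _ | _] = set0)//; apply/seteqP; split.
Qed.

Lemma unif_itv (c : R) : 0 <= c <= 1 -> unif (`]0, 1[ `&` `]-oo, c]) = c%:E.
Proof.
move=> /andP[c0 c1]; rewrite /unif/= /uniform_prob.
rewrite (eq_integral (fun=> 1%:E)); last first.
  move=> x /set_mem[/=]; rewrite !in_itv/= => /andP[x0 x1] _.
  by rewrite /uniform_pdf !ltW//= subr0 invr1.
rewrite integral_cst ?mul1e/=; last exact: measurableI.
have [c1'|c1'] := ltP c 1.
  rewrite (_ : _ `&` _ = `]0, c]%classic).
    rewrite lebesgue_measure_itv/= lte_fin sube0.
    by move: c0; rewrite le_eqVlt => /predU1P[<-|->//]; rewrite ltxx.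
  apply/seteqP; split => x /=; rewrite !in_itv/=; first by move=> [/andP[-> _] ->].
  by move=> /andP[-> xc]; rewrite (le_lt_trans xc c1').
have -> : c = 1 by apply/eqP; rewrite eq_le c1.
rewrite (_ : _ `&` _ = `]0, 1[%classic).
  by rewrite lebesgue_measure_itv/= lte_fin ltr01 sube0.
by apply/setIidl => x /=; rewrite !in_itv/= => /andP[_ /ltW].
Qed.

Lemma unif_out : unif (~` `]0, 1[%classic) = 0%E.
Proof.
have -> : unif (~` `]0, 1[%classic) = (1 - unif `]0%R, 1%R[%classic)%E.
  by rewrite probability_setC.
have := @unif_itv 1; rewrite ler01 lexx => /(_ isT).
rewrite (_ : `]0, 1[ `&` `]-oo, 1] = `]0, 1[%classic) => [->|]; first by rewrite subee.
by apply/setIidl => x /=; rewrite !in_itv/= => /andP[_ /ltW].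
Qed.

(** By [quantileP] the inequality [quantile P u <= x] amounts to
[u <= distr P x], whose probability for a uniform [u] is [distr P x]. *)
Lemma quantile01_law P : P `]-oo, 0[%classic = 0%E ->
  forall A, measurable A -> unif (quantile01 P @^-1` A) = P A.
Proof.
move=> P0 A mA; have [Q [QA _]] := exists_law unif (measurable_quantile01 P0).
rewrite -QA; apply: distr_eq => // x; apply/EFin_inj; rewrite -!distrE QA.
have mOut : measurable (~` `]0, 1[%classic : set (measurableTypeR R)) by apply: measurableC.
have m0x : measurable ([set _ | 0 <= x] : set (measurableTypeR R)).
  have [x0|x0] := leP 0 x.
    by rewrite (_ : [set _ | _] = setT)//; apply/seteqP.
  by rewrite (_ : [set _ | _] = set0)//; apply/seteqP; split.
pose A1 : set (measurableTypeR R) := `]0, 1[ `&` `]-oo, distr P x].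
pose A2 : set (measurableTypeR R) := ~` `]0, 1[ `&` [set _ | 0 <= x].
have mA1 : measurable A1 by exact: measurableI.
have mA2 : measurable A2 by exact: measurableI.
have h1 : unif A1 = (distr P x)%:E by apply: unif_itv; rewrite distr_ge0 distr_le1.
have h2 : unif A2 = 0%E.
  by apply/eqP; rewrite eq_le measure_ge0 andbT -unif_out le_measure ?inE// => u [].
rewrite (quantile01_preimage x P0) distrE.
transitivity (unif A1 + unif A2)%E.
  apply: measureU => //.
  by apply/seteqP; split => // u /= [[u1 _] []].
by rewrite h1 h2 adde0.
Qed.

(** Represent all the laws on one space, as quantiles of a uniform variable.
Decreasing distribution functions give increasing quantiles, tightness
bounds them, and so they converge pointwise. *)
Lemma limit_law (P : nat -> law) : (forall n, P n `]-oo, 0[%classic = 0%E) ->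
  (forall n x, (P n.+1 `]-oo, x]%classic <= P n `]-oo, x]%classic)%E) ->
  (forall e, 0 < e -> exists K, forall n, 1 - e <= distr (P n) K) ->
  exists L : law, L `[0, +oo[%classic = 1%E /\ forall t,
    cvgc \oo (fun n => characteristic_function (P n) t) (characteristic_function L t).
Proof.
move=> P0 Pdec Ptight.
pose q n u := quantile01 (P n) u.
have q_inc n u : q n u <= q n.+1 u.
  rewrite /q /quantile01; case: ifPn => // u01; rewrite quantileP//.
  apply: (@le_trans _ _ (distr (P n.+1) (quantile (P n.+1) u))).
    by rewrite -quantileP.
  by rewrite -lee_fin -!distrE.
have q_bd u : exists M, forall n, q n u <= M.
  have [u01|u01] := boolP (0 < u < 1); last first.
    by exists 0 => n; rewrite /q /quantile01 (negbTE u01).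
  have /andP[_ u1] := u01; have u1' : 0 < 1 - u by rewrite subr_gt0.
  have [K KP] := Ptight _ u1'; exists K => n.
  by rewrite /q /quantile01 u01 quantileP//; have := KP n; lra.
have q0 n u : 0 <= q n u.
  rewrite /q /quantile01; case: ifPn => // u01; rewrite leNgt; apply/negP => qn.
  have := quantileP (quantile (P n) u) (P0 n) u01; rewrite lexx distr_neg//.
  by have /andP[u0 _] := u01; rewrite leNgt u0.
(* The limit law is the law of [ql] under the uniform law. *)
pose ql u := limn (fun n => q n u).
have q_cvg u : q n u @[n --> \oo] --> ql u.
  apply: nondecreasing_is_cvgn; first by apply/nondecreasing_seqP => n; exact: q_inc.
  by have [M MP] := q_bd u; exists M => _ [n _ <-].
have mq n : measurable_fun setT (q n : measurableTypeR R -> measurableTypeR R).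
  exact: measurable_quantile01.
have mql : measurable_fun setT (ql : measurableTypeR R -> measurableTypeR R).
  by apply: (measurable_fun_cvg mq) => u _; exact: q_cvg.
have [L [LA Lf]] := exists_law unif mql.
exists L; split.
  rewrite LA (_ : _ @^-1` _ = setT) ?probability_setT//.
  apply/seteqP; split => // u _ /=; rewrite in_itv/= andbT.
  apply: limr_ge; first exact: q_cvg.
  by apply: nearW => n; exact: q0.
have cvE (f : R -> R) : bdd_mfun (f : measurableTypeR R -> R) -> continuous f ->
    \int[P n]_x f x @[n --> \oo] --> \int[L]_x f x.
  move=> bf cf; rewrite Lf//.
  have PE n : \int[P n]_x f x = \int[unif]_u f (q n u).
    have [Q [QA Qf]] := exists_law unif (mq n).
    rewrite -Qf//; congr fine; apply: eq_measure_integral => A mA _.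
    exact: esym (etrans (QA A) (quantile01_law (P0 n) mA)).
  under eq_fun do rewrite PE.
  have [mf [M fM]] := bf.
  have bq n : bdd_mfun (fun u : measurableTypeR R => f (q n u)) by exact: bdd_mfun_comp (mq n) bf.
  have bql : bdd_mfun (fun u : measurableTypeR R => f (ql u)) by exact: bdd_mfun_comp mql bf.
  have iM : unif.-integrable setT (fun _ : measurableTypeR R => M%:E).
    exact: (bdd_mfun_integrable unif (@bdd_mfun_cst _ (measurableTypeR R) R M)).
  have [|||||_ _] := @dominated_convergence _ _ R unif setT measurableT
    (fun n u => (f (q n u))%:E) (fun u => (f (ql u))%:E) (fun=> M%:E).
  - by move=> n; apply/measurable_EFinP; case: (bq n).
  - by apply/measurable_EFinP; case: bql.
  - apply: aeW => u _; apply: cvg_EFin; first exact: nearW.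
    apply: (@cvg_comp _ _ _ (fun n => q n u) f _ _ _ _ (cf _)); exact: q_cvg.
  - exact: iM.
  - by apply: aeW => u n _; rewrite lee_fin.
  rewrite (EFin_expect unif bql); under eq_fun do rewrite (EFin_expect unif (bq _)).
  by move/fine_cvgP => [].
move=> t; split; apply: cvE.
- exact: bdd_mfun_cos.
- by move=> x; apply: continuous_comp; [apply: cvgM; [exact: cvg_cst|exact: cvg_id]|exact: continuous_cos].
- exact: bdd_mfun_sin.
- by move=> x; apply: continuous_comp; [apply: cvgM; [exact: cvg_cst|exact: cvg_id]|exact: continuous_sin].
Qed.

End quantile.

(** * Tightness of the partial laws *)

Section convergence_of_laws.
Context {R : realType}.
Notation law := (probability (measurableTypeR R) R).

(** At [-1] the modulus of the product is the product of the [1 + (a i)^-1],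
which is at least 1 plus the sum of the [(a i)^-1]. *)
Lemma sum_inv_bounded (g : R[i] -> R[i]) (a : nat -> R) : (forall n, 0 < a n) ->
  cvgc \oo (fun n => canonical_product a n (-1)) (g (-1)) ->
  exists2 B : R, 0 < B & forall n, \sum_(i < n) (a i)^-1 <= B.
Proof.
move=> a0 cg; pose s n := \prod_(i < n) (1 + (a i)^-1).
have sE n : nc (canonical_product a n (-1)) = s n.
  rewrite /s /canonical_product; elim: n => [|n ih]; first by rewrite !big_ord0 nc1.
  rewrite !big_ord_recr/= ncM ih; congr (_ * _).
  rewrite mulN1r opprK -fmorphV/= (_ : 1 = (1 : R)%:C)// -rmorphD/= nc_real ger0_norm//.
  by rewrite addr_ge0// invr_ge0 ltW.
have s1 n : 1 + \sum_(i < n) (a i)^-1 <= s n.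
  rewrite /s; elim: n => [|n ih]; first by rewrite !big_ord0 addr0.
  rewrite !big_ord_recr/=; have an : 0 < (a n)^-1 by rewrite invr_gt0.
  have S0 : 0 <= \sum_(i < n) (a i)^-1.
    by apply: sumr_ge0 => i _; rewrite invr_ge0 ltW.
  have := ler_wpM2r (ltW (addr_gt0 ltr01 an)) ih.
  by move: (\sum_(i < n) _) S0 => S S0; have := mulr_ge0 S0 (ltW an); lra.
have s_inc : nondecreasing_seq s.
  apply/nondecreasing_seqP => n; rewrite /s big_ord_recr/= ler_peMr//.
    by apply: prodr_ge0 => i _; rewrite addr_ge0// invr_ge0 ltW.
  by rewrite lerDl invr_ge0 ltW.
have sg : s n @[n --> \oo] --> nc (g (-1)).
  by under eq_fun do rewrite -sE; exact: cvgc_norm.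
have B1 n : s n <= nc (g (-1)).
  have := nondecreasing_cvgn_le s_inc (cvgP _ sg) n.
  by rewrite (cvg_lim _ sg).
exists (nc (g (-1))) => [|n]; last by have := s1 n; have := B1 n; lra.
by apply: lt_le_trans (B1 0%N); rewrite /s big_ord0.
Qed.

(** Markov's inequality for [damp l]. *)
Lemma tail_le_damp (P : law) (l K : R) : 0 < l -> 0 <= K ->
  (1 - distr P K) * (1 - expR (- l * K)) <= \int[P]_x damp l x.
Proof.
move=> l0 K0; have mK : measurable (`]K, +oo[%classic : set (measurableTypeR R)) by [].
have bi := @bdd_mfun_indic _ _ R _ mK.
have <- : \int[P]_x \1_(`]K, +oo[) x = 1 - distr P K.
  rewrite expect_indic// -setCitvl probability_setC// distrE.
  by [].
rewrite mulrC -expectZ//; apply: le_expect; first exact: bdd_mfunZ.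
  exact: bdd_mfun_damp (ltW l0).
move=> x; rewrite indicE; have [/set_mem|_] := boolP (x \in _).
  rewrite /= in_itv/= andbT mulr1 => Kx; rewrite /damp lerD2l lerN2 ler_expR.
  rewrite !mulNr lerN2 ler_pM2l//; exact: le_trans (ltW Kx) (ler_norm x).
by rewrite mulr0 damp_ge0// ltW.
Qed.

Lemma tight_of_damp (P : nat -> law) (a : nat -> R) (B : R) : 0 < B ->
  (forall n, \sum_(i < n) (a i)^-1 <= B) ->
  (forall n l, 0 < l -> \int[P n]_x damp l x <= \sum_(i < n) l / a i) ->
  forall e, 0 < e -> exists K, forall n, 1 - e <= distr (P n) K.
Proof.
move=> B0 aB PB e e0; pose l := e / (2 * B).
have l0 : 0 < l by rewrite divr_gt0// mulr_gt0.
(* With [l = e / (2 * B)] the expectation of [damp l] is at most [e / 2], and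
   [damp l] is at least [1 - expR (-1) >= 1 / 2] beyond [l^-1]. *)
exists l^-1 => n.
have lK : - l * l^-1 = -1 by rewrite mulNr divff// gt_eqF.
have h1 : expR (-1) <= 2^-1 :> R.
  rewrite expRN lef_pV2 ?posrE ?expR_gt0//.
  by have := expR_ge1Dx (1 : R); lra.
have K0 : 0 <= l^-1 by rewrite invr_ge0 ltW.
have := tail_le_damp (P n) l0 K0; rewrite lK => h2.
have h3 : \sum_(i < n) l / a i <= e / 2.
  rewrite -mulr_sumr; apply: le_trans (ler_wpM2l (ltW l0) (aB n)) _.
  by rewrite /l le_eqVlt; apply/orP; left; apply/eqP; field; rewrite gt_eqF.
have h4 := PB n l l0; have d1 := distr_le1 (P n) l^-1.
have : (1 - distr (P n) l^-1) * 2^-1 <= (1 - distr (P n) l^-1) * (1 - expR (-1)).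
  by apply: ler_wpM2l; lra.
lra.
Qed.

End convergence_of_laws.

Theorem proposition2p1 (R : realType) (g h : R[i] -> R[i]) (a b : nat -> R)
    (g_entire : entire g) (h_entire : entire h)
    (g_order : (0 < growth_order g < 1)%E)
    (h_order : (0 < growth_order h < 1)%E)
    (g0 : g 0 = 1) (h0 : h 0 = 1)
    (a_incr : increasing_positive_seq a)
    (g_zeros : simple_zeros_given_by g a)
    (b_incr : increasing_positive_seq b)
    (h_zeros : simple_zeros_given_by h b)
    (a_lt_b : forall n, a n < b n) :
  exists P : probability (measurableTypeR R) R,
    P `[0, +oo[%classic = 1%E /\
    forall t : R, characteristic_function P t = h (0 +i* t) / g (0 +i* t).
Proof.
have a_gt0 n : 0 < a n by case: a_incr.
have product (f : R[i] -> R[i]) (c : nat -> R) : entire f -> (growth_order f < 1)%E ->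
    f 0 = 1 -> increasing_positive_seq c -> simple_zeros_given_by f c ->
    forall z, cvgc \oo (fun n => canonical_product c n z) (f z).
  move=> ef fo f0 ci [fz fs]; have df := entire_cdif ef.
  have fc n : f (c n)%:C = 0.
    by have : [set z | f z = 0] (c n)%:C by rewrite fz; exists n.
  apply: cvgc_canonical_product => //; last exact: growth_order_lt1.
  move=> n K cK fK; apply: (simple_zero_cofactor _ (ef _) (fs _ (fc n)) cK fK).
  by rewrite -nc_gt0 nc_real normr_gt0 gt_eqF//; case: ci.
have /andP[_ go] := g_order; have /andP[_ ho] := h_order.
have cg := product g a g_entire go g0 a_incr g_zeros.
have ch := product h b h_entire ho h0 b_incr h_zeros.
have [P [P0 Pcf Pdec Pdamp]] := exists_partial_laws a_gt0 a_lt_b.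
have [B B0 aB] := sum_inv_bounded a_gt0 (cg (-1)).
have [L [L1 Lcf]] := limit_law P0 Pdec (tight_of_damp B0 aB Pdamp).
exists L; split => // t.
have gt0 : g (0 +i* t) != 0.
  apply/eqP => gt; have : [set z | g z = 0] (0 +i* t) by [].
  rewrite g_zeros.1 => -[n _] /(congr1 (@complex.Re R))/= an.
  by have := a_gt0 n; rewrite an ltxx.
apply: (cvgc_unique (Lcf t)).
under eq_fun do rewrite Pcf.
by apply: cvgcM; [exact: ch|apply: cvgcV; [exact: gt0|exact: cg]].
Qed.
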